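(* Let $N(c)$ be a $(2m+1)$-dimensional $(\kappa,\mu)$-contact space form of constant $\varphi$-sectional curvature $c$, endowed with the connection $\overline{\widetilde{\nabla}}_XY=\widehat{\overline{\nabla}}_XY+a\pi(X)Y+b\pi(Y)X$, and let $M^n$, $n\ge 3$, be an $n$-dimensional submanifold of $N(c)$. Then for every $x\in M$ and every $2$-plane section $\Pi\subset T_xM$, \begin{align*} \widetilde\tau(x)-\widetilde K(\Pi)\le{}& \frac{(n+1)(n-2)}{2}\frac{c+3}{4}+\frac{c+3-4\kappa}{4}\left[-(n-1)\|\xi^\top\|^2+\gamma(\Pi)\right]+\frac{c-1}{8}\left[3\|\widehat{P}\|^2-6\beta(\Pi)\right]\\ &+\frac14\left[\|(\varphi h')^\top\|^2-\|(h')^\top\|^2+|\mathrm{tr}((h')^\top)|^2-|\mathrm{tr}((\varphi h')^\top)|^2\right]\\ &-\frac12\left[\det(h'|_\Pi)-\det((\varphi h')|_\Pi)\right]+(n-1)\mathrm{tr}((h')^\top)-\mathrm{tr}(h'|_\Pi)\\ &+(1-\mu)\left[g(\xi^\top,h'\xi^\top)-\mathrm{tr}((h')^\top)\|\xi^\top\|^2+\theta(\Pi)\right]\\ &-\frac{n-1}{2}b\lambda'+\frac{n-1}{2}b^2\|P^\top\|^2-\frac b2(n-1)n\,\pi(\widetilde H)+\frac b2\mathrm{tr}(\alpha'|_\Pi)-\frac{b^2}{2}\|P_\Pi\|^2\\ &+\frac b2\pi(\mathrm{tr}(\widetilde h|_\Pi))+\frac{n^2(n-2)}{2(n-1)}\|\widetilde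 H\|^2 . \end{align*}
   Context: **Ambient manifold.** A Riemannian manifold $(N^{2m+1},g)$ has an almost contact metric structure $(\varphi,\xi,\eta,g)$ if $\varphi$ is a $(1,1)$-tensor field, $\xi$ a vector field, $\eta$ a $1$-form with $\varphi^2X=-X+\eta(X)\xi$, $\eta(\xi)=1$, $\varphi\xi=0$, $\eta\circ\varphi=0$, $g(X,\varphi Y)=-g(\varphi X,Y)$, $g(X,\xi)=\eta(X)$. It is a contact metric manifold if $\Phi=d\eta$, where $\Phi(X,Y)=g(X,\varphi Y)$. Let $\widehat{\overline{\nabla}}$ be the Levi-Civita connection of $g$ and $\widehat{\overline{R}}$ its curvature tensor. The tensor $h'$ defined by $2h'=\mathcal L_\xi\varphi$ is symmetric, and $h'\xi=0$, $h'\varphi+\varphi h'=0$, $\widehat{\overline{\nabla}}\xi=-\varphi-\varphi h'$, and $h'$ and $\varphi h'$ are trace-free on $TN$. $N$ is a $(\kappa,\mu)$-contact metric manifold ($\kappa,\mu$ real constants) if $\widehat{\overline{R}}(X,Y)\xi=\kappa[\eta(Y)X-\eta(X)Y]+\mu[\eta(Y)h'X-\eta(X)h'Y]$. A $\varphi$-section is a plane spanned by $X,\varphi X$ with $X$ a unit vector orthogonal to $\xi$; its sectional curvature is a $\varphi$-sectional curvature. If a $(\kappa,\mu)$-contact metric manifold has constant $\varphi$-sectional curvature $c$ it is called a $(\kappa,\mu)$-contact space form $N(c)$, and its Levi-Civita curvature tensor is \begin{align*}\widehat{\overline{R}}(X,Y)Z={}&\tfrac{c+3}{4}[g(Y,Z)X-g(X,Z)Y]+\tfrac{c+3-4\kappa}{4}[\eta(X)\eta(Z)Y-\eta(Y)\eta(Z)X+g(X,Z)\eta(Y)\xi-g(Y,Z)\eta(X)\xi]\\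 &+\tfrac{c-1}{4}[2g(X,\varphi Y)\varphi Z+g(X,\varphi Z)\varphi Y-g(Y,\varphi Z)\varphi X]\\ &+\tfrac12[g(h'Y,Z)h'X-g(h'X,Z)h'Y+g(\varphi h'X,Z)\varphi h'Y-g(\varphi h'Y,Z)\varphi h'X]\\ &-g(X,Z)h'Y+g(Y,Z)h'X+\eta(X)\eta(Z)h'Y-\eta(Y)\eta(Z)h'X-g(h'X,Z)Y+g(h'Y,Z)X\\ &-g(h'Y,Z)\eta(X)\xi+g(h'X,Z)\eta(Y)\xi\\ &+\mu[\eta(Y)\eta(Z)h'X-\eta(X)\eta(Z)h'Y+g(h'Y,Z)\eta(X)\xi-g(h'X,Z)\eta(Y)\xi].\end{align*} **Connection.** $P$ is a vector field on $N$, $\pi(X)=g(P,X)$, $a,b$ are real constants, and $\overline{\widetilde{\nabla}}_XY=\widehat{\overline{\nabla}}_XY+a\pi(X)Y+b\pi(Y)X$. Put $\alpha'(X,Y)=(\widehat{\overline{\nabla}}_X\pi)(Y)$. **Submanifold.** For tangent $X,Y$ on $M$, $\overline{\widetilde{\nabla}}_XY=\widetilde\nabla_XY+\widetilde h(X,Y)$ is the decomposition into tangential part (induced connection $\widetilde\nabla$) and normal part $\widetilde h$; $\widetilde h$ equals the usual second fundamental form $\widehat h$. $\widetilde R(X,Y)Z=\widetilde\nabla_X\widetilde\nabla_YZ-\widetilde\nabla_Y\widetilde\nabla_XZ-\widetilde\nabla_{[X,Y]}Z$ and $\widetilde R(X,Y,Z,W)=g(\widetilde R(X,Y)Z,W)$.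 Let $e_1,\dots,e_n$ be an orthonormal basis of $T_xM$. $\widetilde H=\frac1n\sum_i\widetilde h(e_i,e_i)$. For a $2$-plane $\Pi$ with orthonormal basis $\{e_1,e_2\}$, $\widetilde K(\Pi)=\frac12[\widetilde R(e_1,e_2,e_2,e_1)-\widetilde R(e_1,e_2,e_1,e_2)]$, and $\widetilde\tau(x)=\sum_{1\le i<j\le n}\widetilde K(e_i\wedge e_j)=\frac12\sum_{i\ne j}\widetilde R(e_i,e_j,e_j,e_i)$. **Notation.** $\lambda'=\mathrm{tr}(\alpha')=\sum_{i=1}^n\alpha'(e_i,e_i)$ (trace over $T_xM$). $\xi^\top$, $P^\top$ are the tangential parts of $\xi$, $P$, and $P_\Pi$ is the orthogonal projection of $P$ to $\Pi$; $\widehat PX$, $(h')^\top X$, $(\varphi h')^\top X$ are the tangential parts of $\varphi X$, $h'X$, $\varphi h'X$ for tangent $X$; $\|\vartheta\|^2=\sum_{i,j=1}^n g(e_i,\vartheta e_j)^2$ and $\mathrm{tr}(\vartheta)=\sum_{i=1}^n g(e_i,\vartheta e_i)$ for $\vartheta\in\{\widehat P,(h')^\top,(\varphi h')^\top\}$. For $\Pi$ with orthonormal basis $\{e_1,e_2\}$: $\beta(\Pi)=g(\varphi e_1,e_2)^2$; $\gamma(\Pi)=\eta(e_1)^2+\eta(e_2)^2$; $\theta(\Pi)=\eta(e_1)^2g(h'e_2,e_2)+\eta(e_2)^2g(h'e_1,e_1)-2\eta(e_1)\eta(e_2)g(h'e_1,e_2)$; $\mathrm{tr}(T|_\Pi)$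 and $\det(T|_\Pi)$ for $T\in\{h',\varphi h'\}$ are the trace and determinant of the $2\times2$ matrix $(g(Te_i,e_j))_{i,j=1,2}$; $\mathrm{tr}(\alpha'|_\Pi)=\sum_{i=1}^2\alpha'(e_i,e_i)$, $\mathrm{tr}(\widetilde h|_\Pi)=\sum_{i=1}^2\widetilde h(e_i,e_i)$. *)

(* Defs.v *)
From HB Require Import structures.
From mathcomp Require Import all_boot all_order all_algebra.
From mathcomp Require Import all_classical all_reals all_analysis.

Set Implicit Arguments.
Unset Strict Implicit.
Unset Printing Implicit Defensive.

Import Order.TTheory GRing.Theory Num.Theory.
Import numFieldNormedType.Exports.

Local Open Scope classical_set_scope.
Local Open Scope ring_scope.

(* Smooth manifolds are given by atlases, and a tensor field is the family of
   its component functions in the charts, subject to smoothness and to the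
   usual transformation law.  Vectors are row vectors, so a (1,1)-tensor [A]
   sends [u] to [u *m A] and a 1-form [w] has the column of its components. *)

(* C^oo on the open set [U]: all iterated directional derivatives exist and
   are differentiable on [U]. *)
Definition smooth_on (R : realType) (d : nat) (V : normedModType R)
    (U : set 'rV[R]_d) (f : 'rV[R]_d -> V) : Prop :=
  forall (s : seq 'rV[R]_d) (x : 'rV[R]_d), U x ->
    differentiable (foldr (fun v (k : 'rV[R]_d -> V) => 'D_v k) f s) x.

Record manifold (R : realType) (d : nat) := Manifold {
  msort :> topologicalType;
  mhausdorff : hausdorff_space msort;
  msecond_countable : @second_countable msort;
  mindex : Type;
  mdom : mindex -> set msort;
  chart : mindex -> msort -> 'rV[R]_d;
  param : mindex -> 'rV[R]_d -> msort;
  mdom_cover : forall x, exists i, mdom i x;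
  mdom_open : forall i, open (mdom i);
  mcoord_open : forall i, open (chart i @` mdom i);
  chartK : forall i x, mdom i x -> param i (chart i x) = x;
  chart_continuous : forall i, {within mdom i, continuous (chart i)};
  param_continuous :
    forall i, {within chart i @` mdom i, continuous (param i)};
  trans_smooth : forall i j,
    smooth_on [set y | (chart i @` mdom i) y /\ mdom j (param i y)]
              (chart j \o param i)
}.

Section Tensors.
Variables (R : realType) (d : nat) (N : manifold R d).
Implicit Types (i j : mindex N) (y u v : 'rV[R]_d).

Definition mcoord i : set 'rV[R]_d := chart i @` mdom i.
Definition overlap i j : set 'rV[R]_d :=
  [set y | mcoord i y /\ mdom j (param i y)].
Definition trans i j : 'rV[R]_d -> 'rV[R]_d := chart j \o param i.

Definition inner (G : 'M[R]_d) u v : R := (u *m G *m v^T) 0 0.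

Record vector_field := VectorField {
  vf_comp :> mindex N -> 'rV[R]_d -> 'rV[R]_d;
  vf_smooth : forall i, smooth_on (mcoord i) (vf_comp i);
  vf_trans : forall i j y, overlap i j y ->
    vf_comp j (trans i j y) = 'd (trans i j) y (vf_comp i y)
}.

Record one_form := OneForm {
  of_comp :> mindex N -> 'rV[R]_d -> 'cV[R]_d;
  of_smooth : forall i, smooth_on (mcoord i) (of_comp i);
  of_trans : forall i j y u, overlap i j y ->
    'd (trans i j) y u *m of_comp j (trans i j y) = u *m of_comp i y
}.

Record endo_field := EndoField {
  ef_comp :> mindex N -> 'rV[R]_d -> 'M[R]_d;
  ef_smooth : forall i, smooth_on (mcoord i) (ef_comp i);
  ef_trans : forall i j y u, overlap i j y ->
    'd (trans i j) y u *m ef_comp j (trans i j y)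
    = 'd (trans i j) y (u *m ef_comp i y)
}.

Record metric := Metric {
  mt_comp :> mindex N -> 'rV[R]_d -> 'M[R]_d;
  mt_smooth : forall i, smooth_on (mcoord i) (mt_comp i);
  mt_trans : forall i j y u v, overlap i j y ->
    inner (mt_comp j (trans i j y)) ('d (trans i j) y u) ('d (trans i j) y v)
    = inner (mt_comp i y) u v;
  mt_sym : forall i y, mcoord i y -> (mt_comp i y)^T = mt_comp i y;
  mt_pos : forall i y u, mcoord i y -> u != 0 -> 0 < inner (mt_comp i y) u u
}.

End Tensors.

Section LocalGeometry.
Variables (R : realType) (d : nat).
Local Notation field := ('rV[R]_d -> 'rV[R]_d).
Implicit Types (X Y Z xi : field) (x u v w : 'rV[R]_d).
Implicit Types (g phi : 'rV[R]_d -> 'M[R]_d) (eta : 'rV[R]_d -> 'cV[R]_d).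

Definition bracket X Y : field := fun x => 'D_(X x) Y x - 'D_(Y x) X x.

Definition curvature (nab : field -> field -> field) X Y Z : field := fun x =>
  nab X (nab Y Z) x - nab Y (nab X Z) x - nab (bracket X Y) Z x.

(* Tensors obtained by differentiating vector fields are evaluated at tangent
   vectors by extending the latter to constant fields in the chart. *)
Definition curvature_at (nab : field -> field -> field) x u v w : 'rV[R]_d :=
  curvature nab (cst u) (cst v) (cst w) x.

(* The vector [Gamma] such that
   2 g (Gamma, w) = D_u g (v, w) + D_v g (u, w) - D_w g (u, v) for all [w]. *)
Definition christoffel g x u v : 'rV[R]_d :=
  (\row_(k < d) (2^-1 *
     ('D_u (fun y => inner (g y) v (delta_mx 0 k)) x
      + 'D_v (fun y => inner (g y) u (delta_mx 0 k)) x
      - 'D_(delta_mx 0 k) (fun y => inner (g y) u v) x))) *m invmx (g x).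

Definition levi_civita g X Y : field := fun x =>
  'D_(X x) Y x + christoffel g x (X x) (Y x).

Definition lie_endo phi xi X : field := fun x =>
  bracket xi (fun y => X y *m phi y) x - bracket xi X x *m phi x.

Definition hprime phi xi x u : 'rV[R]_d :=
  2^-1 *: lie_endo phi xi (cst u) x.

Definition ev1 (w : 'cV[R]_d) u : R := (u *m w) 0 0.

(* The factor 1/2 is the convention under which Phi = d eta is compatible with
   nabla xi = - phi - phi h'. *)
Definition d_one_form eta X Y x : R :=
  2^-1 * ('D_(X x) (fun y => ev1 (eta y) (Y y)) x
          - 'D_(Y x) (fun y => ev1 (eta y) (X y)) x
          - ev1 (eta x) (bracket X Y x)).

(* (nabla_X pi)(Y) for the Levi-Civita connection and pi = g (P, -). *)
Definition nabla_dual g (P : field) X Y x : R :=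
  'D_(X x) (fun y => inner (g y) (P y) (Y y)) x
  - inner (g x) (P x) (levi_civita g X Y x).

(* Sectional curvature of the plane with orthonormal basis [u], [v]. *)
Definition sectional g x u v : R :=
  inner (g x) (curvature_at (levi_civita g) x u v v) u.

Definition space_form_curvature (kappa mu c : R) (G : 'M[R]_d)
    (phi h : 'rV[R]_d -> 'rV[R]_d) (xi : 'rV[R]_d) (eta : 'rV[R]_d -> R)
    (X Y Z : 'rV[R]_d) : 'rV[R]_d :=
  let g := inner G in
  ((c + 3) / 4) *: (g Y Z *: X - g X Z *: Y)
  + ((c + 3 - 4 * kappa) / 4) *:
      ((eta X * eta Z) *: Y - (eta Y * eta Z) *: X
       + (g X Z * eta Y) *: xi - (g Y Z * eta X) *: xi)
  + ((c - 1) / 4) *: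
      ((2 * g X (phi Y)) *: phi Z + g X (phi Z) *: phi Y
       - g Y (phi Z) *: phi X)
  + 2^-1 *:
      (g (h Y) Z *: h X - g (h X) Z *: h Y
       + g (phi (h X)) Z *: phi (h Y) - g (phi (h Y)) Z *: phi (h X))
  - g X Z *: h Y + g Y Z *: h X
  + (eta X * eta Z) *: h Y - (eta Y * eta Z) *: h X
  - g (h X) Z *: Y + g (h Y) Z *: X
  - (g (h Y) Z * eta X) *: xi + (g (h X) Z * eta Y) *: xi
  + mu *:
      ((eta Y * eta Z) *: h X - (eta X * eta Z) *: h Y
       + (g (h Y) Z * eta X) *: xi - (g (h X) Z * eta Y) *: xi).

End LocalGeometry.

Section ContactSpaceForms.
Variables (R : realType) (d : nat) (N : manifold R d).
Variables (g : metric N) (phi : endo_field N) (xi : vector_field N).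
Variable eta : one_form N.

Record almost_contact_metric : Prop := AlmostContactMetric {
  acm_phi2 : forall i y u, mcoord i y ->
    u *m phi i y *m phi i y = - u + ev1 (eta i y) u *: xi i y;
  acm_eta_xi : forall i y, mcoord i y -> ev1 (eta i y) (xi i y) = 1;
  acm_phi_xi : forall i y, mcoord i y -> xi i y *m phi i y = 0;
  acm_eta_phi : forall i y u, mcoord i y -> ev1 (eta i y) (u *m phi i y) = 0;
  acm_skew : forall i y u v, mcoord i y ->
    inner (g i y) u (v *m phi i y) = - inner (g i y) (u *m phi i y) v;
  acm_dual : forall i y u, mcoord i y ->
    inner (g i y) u (xi i y) = ev1 (eta i y) u
}.

Definition contact_metric : Prop :=
  almost_contact_metric /\
  forall i y u v, mcoord i y ->
    inner (g i y) u (v *m phi i y) = d_one_form (eta i) (cst u) (cst v) y.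

Definition kappa_mu_contact (kappa mu : R) : Prop :=
  contact_metric /\
  forall i y u v, mcoord i y ->
    curvature_at (levi_civita (g i)) y u v (xi i y) =
    kappa *: (ev1 (eta i y) v *: u - ev1 (eta i y) u *: v)
    + mu *: (ev1 (eta i y) v *: hprime (phi i) (xi i) y u
             - ev1 (eta i y) u *: hprime (phi i) (xi i) y v).

Definition constant_phi_sectional (c : R) : Prop :=
  forall i y u, mcoord i y ->
    inner (g i y) u u = 1 -> inner (g i y) u (xi i y) = 0 ->
    sectional (g i) y u (u *m phi i y) = c.

(* [csf_curvature] is Koufogiorgos' expression of the curvature; it is a
   consequence of the other two fields and is taken as part of the notion of
   contact space form N(c). *)
Record contact_space_form (kappa mu c : R) : Prop := ContactSpaceForm {
  csf_kappa_mu : kappa_mu_contact kappa mu;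
  csf_phi_sectional : constant_phi_sectional c;
  csf_curvature : forall i y u v w, mcoord i y ->
    curvature_at (levi_civita (g i)) y u v w =
    space_form_curvature kappa mu c (g i y)
      (fun z => z *m phi i y) (hprime (phi i) (xi i) y)
      (xi i y) (ev1 (eta i y)) u v w
}.

End ContactSpaceForms.

Section Submanifolds.
Variables (R : realType) (n d : nat).

Definition local_rep (M : manifold R n) (N : manifold R d) (F : M -> N)
    (i : mindex M) (j : mindex N) : 'rV[R]_n -> 'rV[R]_d :=
  chart j \o F \o param i.

Definition immersion (M : manifold R n) (N : manifold R d) (F : M -> N) :
    Prop :=
  continuous F /\
  forall i j,
    let U := [set y | mcoord i y /\ mdom j (F (param i y))] in
    smooth_on U (local_rep F i j) /\
    forall y, U y -> injective ('d (local_rep F i j) y).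

Variables (g : 'rV[R]_d -> 'M[R]_d) (P : 'rV[R]_d -> 'rV[R]_d) (a b : R).
Variable f : 'rV[R]_n -> 'rV[R]_d.
Implicit Types (X Y : 'rV[R]_n -> 'rV[R]_n) (y u v : 'rV[R]_n).

Definition pullback y : 'M[R]_n :=
  jacobian f y *m g (f y) *m (jacobian f y)^T.

(* The tangent vector of the submanifold (in its own chart) whose image under
   the differential of [f] is the orthogonal projection of [W]. *)
Definition tangential y (W : 'rV[R]_d) : 'rV[R]_n :=
  W *m g (f y) *m (jacobian f y)^T *m invmx (pullback y).

(* The ambient connection nabla_X Y + a pi(X) Y + b pi(Y) X applied to fields
   tangent to the submanifold, as a vector field along [f]. *)
Definition ambient_conn X Y y : 'rV[R]_d :=
  let dX := 'd f y (X y) in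
  let dY := 'd f y (Y y) in
  'D_(X y) (fun z => 'd f z (Y z)) y + christoffel g (f y) dX dY
  + (a * inner (g (f y)) (P (f y)) dX) *: dY
  + (b * inner (g (f y)) (P (f y)) dY) *: dX.

Definition induced_conn X Y y : 'rV[R]_n :=
  tangential y (ambient_conn X Y y).

Definition second_fund X Y y : 'rV[R]_d :=
  ambient_conn X Y y - 'd f y (induced_conn X Y y).

Definition sff y u v : 'rV[R]_d := second_fund (cst u) (cst v) y.

Definition induced_riem y u v w z : R :=
  inner (pullback y) (curvature_at induced_conn y u v w) z.

(* [u], [v] orthonormal. *)
Definition induced_sectional y u v : R :=
  2^-1 * (induced_riem y u v v u - induced_riem y u v u v).

Definition induced_scalar y (e : 'I_n -> 'rV[R]_n) : R :=
  \sum_(i < n) \sum_(j < n | (i < j)%N) induced_sectional y (e i) (e j).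

Definition mean_curvature y (e : 'I_n -> 'rV[R]_n) : 'rV[R]_d :=
  n%:R^-1 *: \sum_(i < n) sff y (e i) (e i).

End Submanifolds.

Definition orthonormal_fam (R : realType) (n k : nat) (G : 'M[R]_n)
    (e : 'I_k -> 'rV[R]_n) : Prop :=
  forall i j, inner G (e i) (e j) = (i == j)%:R.

(* For an ambient endomorphism [T] and an orthonormal family [e], the trace,
   squared norm and (for planes) determinant of the matrix (g (T e_i, e_j)). *)
Definition tr_on (R : realType) (d k : nat) (G : 'M[R]_d)
    (T : 'rV[R]_d -> 'rV[R]_d) (e : 'I_k -> 'rV[R]_d) : R :=
  \sum_(i < k) inner G (e i) (T (e i)).

Definition sqnorm_on (R : realType) (d k : nat) (G : 'M[R]_d)
    (T : 'rV[R]_d -> 'rV[R]_d) (e : 'I_k -> 'rV[R]_d) : R :=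
  \sum_(i < k) \sum_(j < k) inner G (e i) (T (e j)) ^+ 2.

Definition det_on (R : realType) (d k : nat) (G : 'M[R]_d)
    (T : 'rV[R]_d -> 'rV[R]_d) (e : 'I_k -> 'rV[R]_d) : R :=
  \det (\matrix_(i < k, j < k) inner G (T (e i)) (e j)).

(* Main.v *)
(* The connection induced on M is again of the form nabla + a pi(X) Y + b pi(Y) X
   for the induced metric, so the Gauss equation expresses its curvature through
   the ambient curvature, the tensor alpha' and the second fundamental form. In
   the symmetrized sectional curvature the terms in a cancel and those in b only
   depend on the two directions separately. Summing over pairs of basis vectors
   turns the statement into Chen's algebraic inequality for a symmetric bilinear
   form N with trace H and a plane of orthonormal vectors s, t:
     |N|^2 + 2 (<N(s,s), N(t,t)> - |N(s,t)|^2) >= |H|^2 / (n - 1).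
   The latter follows by expanding the square of the difference between N and
   the form that agrees with N on the plane, vanishes between the plane and its
   complement, and is a multiple of the metric on the complement. The symmetry of
   h' and phi h' is proved from the vanishing of the Lie derivatives of eta and
   d eta along xi. *)

(* Chen's algebraic inequality is the only estimate; everything else is an exact identity, and the
   last step shows that the slack of the goal is the slack of that inequality. The plane need not be
   spanned by vectors of the frame [e], hence the inequality is stated for a form given by its
   matrix in [e] and for the coordinate vectors of a basis of the plane. Its constant comes from a
   second square: once the trace T on the complement is averaged over n-2 dimensions, |T|^2/(n-2) +
   |N0+N1|^2 has to be compared with |T+N0+N1|^2/(n-1), where N0 and N1 are the values on the basis
   of the plane. The analytic obstacle is that curvature is second order. Along constant fields
   brackets vanish, and what is needed is commutation of second derivatives, proved from
   differentiability alone. The projection onto the submanifold contains the inverse of the induced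
   metric, but its derivative is never computed: it suffices that the normal part is differentiable
   and that its orthogonality to tangent vectors can be differentiated. *)
Require Import Defs.
From HB Require Import structures.
From mathcomp Require Import all_boot all_order all_algebra.
From mathcomp Require Import all_classical all_reals all_analysis.
From mathcomp Require Import ring lra.

Set Implicit Arguments.
Unset Strict Implicit.
Unset Printing Implicit Defensive.

Import Order.TTheory GRing.Theory Num.Theory.
Import numFieldNormedType.Exports.

Local Open Scope classical_set_scope.
Local Open Scope ring_scope.

(** * Calculus of matrix-valued functions *)

Section Calculus.
Variables (R : realType) (V : normedModType R).

(** ['d] is chosen among the continuous linear maps that satisfy the first-order expansion, so it is
    enough to exhibit one: the differential of [f] works for [g], since the expansion only involves
    values near the point. *)
Lemma near_eq_differentiable (W : normedModType R) (f g : V -> W) (x : V) :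
  (\forall z \near x, f z = g z) -> differentiable f x -> differentiable g x.
Proof.
move=> fg df; apply/diffP => /=.
apply: (@getPex _ (fun (df : {linear V -> W}) => continuous df /\
  forall y, g y = g (lim (nbhs x)) + df (y - lim (nbhs x))
                  +o_(y \near x) (y - lim (nbhs x)))).
exists ('d f x); split; first exact: diff_continuous.
have [_ /funext/eqaddoP E] := (diffP _ _).1 df.
suff E2 : g = (fun y => g (lim (nbhs x)) + 'd f x (y - lim (nbhs x)))
            +o_x (fun y => y - lim (nbhs x)).
  by move=> y; exact: (congr1 (fun k => k y) E2).
apply/eqaddoP => e e0; move: (E e e0); apply: filter_app.
  have fgx := nbhs_singleton fg.
  near=> z.
  rewrite /= !fctE lim_id // -fgx.
  by have <- : f z = g z by near: z.
Unshelve. all: by end_near. Qed.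

Lemma deriveE_comp (W Z : normedModType R) (f : V -> W) (h : W -> Z)
    (x u : V) :
  differentiable f x -> differentiable h (f x) ->
  'D_u (fun z => h (f z)) x = 'D_('D_u f x) h (f x).
Proof.
move=> df dh; rewrite (deriveE _ df) (deriveE _ dh).
rewrite (deriveE u (differentiable_comp df dh)).
exact: (congr1 (fun k => k u) (diff_comp df dh)).
Qed.

Section Matrix.
Variables (m n : nat).
Implicit Types (A B : V -> 'M[R]_(m, n)).

Lemma differentiable_mxP A x :
  differentiable A x <-> forall i j, differentiable (fun z => A z i j) x.
Proof.
split=> [dA i j|dA].
  exact: (@differentiable_comp _ _ _ _ A (fun M => M i j) x dA
            (differentiable_coord _ i j)).
have -> : A = \sum_(i < m) \sum_(j < n) (fun z => A z i j *: delta_mx i j).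
  apply/funext => z; rewrite fct_sumE {1}[A z]matrix_sum_delta.
  by apply: eq_bigr => i _; rewrite fct_sumE.
apply: differentiable_sum => i; apply: differentiable_sum => j.
exact: differentiableZl.
Qed.

Lemma differentiable_entry A x i j :
  differentiable A x -> differentiable (fun z => A z i j) x.
Proof. by move=> /differentiable_mxP. Qed.

Lemma derive_coord A x u i j : differentiable A x ->
  ('D_u A x) i j = 'D_u (fun z => A z i j) x.
Proof. by move=> /(@diff_derivable _ _ _ _ _ u)/derive_mx ->; rewrite mxE. Qed.

End Matrix.

Lemma differentiable_sumf (W : normedModType R) (I : Type) (r : seq I)
    (P : pred I) (F : I -> V -> W) x :
  (forall i, P i -> differentiable (F i) x) ->
  differentiable (fun z => \sum_(i <- r | P i) F i z) x.
Proof.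
move=> dF; have -> : (fun z => \sum_(i <- r | P i) F i z) =
    \sum_(i <- r | P i) F i by apply/funext => z; rewrite fct_sumE.
by elim/big_ind : _ => //= f g; exact: differentiableD.
Qed.

Lemma derive_sumf (W : normedModType R) (I : finType) (F : I -> V -> W) x u :
  (forall i, differentiable (F i) x) ->
  'D_u (fun z => \sum_i F i z) x = \sum_i 'D_u (F i) x.
Proof.
move=> dF; have -> : (fun z => \sum_i F i z) =
    \sum_i F i by apply/funext => z; rewrite fct_sumE.
elim: (index_enum I) => [|i r IH]; first by rewrite !big_nil derive_cst.
rewrite !big_cons -IH deriveD //; first exact: diff_derivable.
apply: diff_derivable.
have -> : \sum_(j <- r) F j = (fun z => \sum_(j <- r) F j z).
  by apply/funext => z; rewrite fct_sumE.
exact: differentiable_sumf.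
Qed.

Lemma differentiable_prodf (I : Type) (r : seq I) (F : I -> V -> R) x :
  (forall i, differentiable (F i) x) ->
  differentiable (fun z => \prod_(i <- r) F i z) x.
Proof.
move=> dF; elim: r => [|i r IH].
  have -> : (fun z => \prod_(i <- [::]) F i z) = cst 1.
    by apply/funext => z; rewrite big_nil.
  exact: differentiable_cst.
have -> : (fun z => \prod_(j <- i :: r) F j z) =
    F i * (fun z => \prod_(j <- r) F j z).
  by apply/funext => z; rewrite big_cons.
exact: differentiableM.
Qed.

Lemma derive_addf (W : normedModType R) (f h : V -> W) x u :
  differentiable f x -> differentiable h x ->
  'D_u (fun z => f z + h z) x = 'D_u f x + 'D_u h x.
Proof. by move=> df dh; apply: deriveD; exact: diff_derivable. Qed.

Lemma derive_subf (W : normedModType R) (f h : V -> W) x u :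
  differentiable f x -> differentiable h x ->
  'D_u (fun z => f z - h z) x = 'D_u f x - 'D_u h x.
Proof. by move=> df dh; apply: deriveB; exact: diff_derivable. Qed.

Lemma derive_mulf (h k : V -> R) x u :
  differentiable h x -> differentiable k x ->
  'D_u (fun z => h z * k z) x = 'D_u h x * k x + h x * 'D_u k x.
Proof.
move=> dh dk.
rewrite [LHS](deriveM (@diff_derivable _ _ _ _ _ u dh)
  (@diff_derivable _ _ _ _ _ u dk)).
by rewrite addrC [k x *: _]mulrC.
Qed.

Lemma derive_mulcf (k : R) (h : V -> R) x u :
  differentiable h x -> 'D_u (fun z => k * h z) x = k * 'D_u h x.
Proof.
move=> dh; rewrite (derive_mulf u (differentiable_cst k x) dh).
by rewrite derive_cst mul0r add0r.
Qed.

Section Product.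
Variables (m n p : nat) (A : V -> 'M[R]_(m, n)) (B : V -> 'M[R]_(n, p)) (x : V).
Hypotheses (dA : differentiable A x) (dB : differentiable B x).

Lemma differentiable_mulmx : differentiable (fun z => A z *m B z) x.
Proof.
apply/differentiable_mxP => i j.
have -> : (fun z => (A z *m B z) i j) = (fun z => \sum_k A z i k * B z k j).
  by apply/funext => z; rewrite mxE.
apply: differentiable_sumf => k _.
by apply: differentiableM; exact: differentiable_entry.
Qed.

Lemma derive_mulmx u :
  'D_u (fun z => A z *m B z) x = 'D_u A x *m B x + A x *m 'D_u B x.
Proof.
have dAc i k : differentiable (fun z => A z i k) x by exact: differentiable_entry.
have dBc i k : differentiable (fun z => B z i k) x by exact: differentiable_entry.
apply/matrixP => i j; rewrite derive_coord; last exact: differentiable_mulmx.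
have -> : (fun z => (A z *m B z) i j) = (fun z => \sum_k A z i k * B z k j).
  by apply/funext => z; rewrite mxE.
rewrite derive_sumf; last by move=> k; exact: differentiableM.
rewrite !mxE -big_split; apply: eq_bigr => k _.
by rewrite derive_mulf // -!derive_coord.
Qed.

End Product.

Lemma differentiable_tr m n (A : V -> 'M[R]_(m, n)) x :
  differentiable A x -> differentiable (fun z => (A z)^T) x.
Proof.
move=> /differentiable_mxP dA; apply/differentiable_mxP => i j.
have -> : (fun z => (A z)^T i j) = (fun z => A z j i).
  by apply/funext => z; rewrite mxE.
exact: dA.
Qed.

Lemma derive_tr m n (A : V -> 'M[R]_(m, n)) x u :
  differentiable A x -> 'D_u (fun z => (A z)^T) x = ('D_u A x)^T.
Proof.
move=> dA; apply/matrixP => i j.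
rewrite derive_coord; last exact: differentiable_tr.
rewrite mxE derive_coord //.
have -> // : (fun z => (A z)^T i j) = (fun z => A z j i).
by apply/funext => z; rewrite mxE.
Qed.

Lemma differentiable_scalef m n (k : V -> R) (A : V -> 'M[R]_(m, n)) x :
  differentiable k x -> differentiable A x ->
  differentiable (fun z => k z *: A z) x.
Proof.
move=> dk /differentiable_mxP dA; apply/differentiable_mxP => i j.
have -> : (fun z => (k z *: A z) i j) = k * (fun z => A z i j).
  by apply/funext => z; rewrite mxE.
exact: differentiableM.
Qed.

Lemma derive_scalef m n (k : V -> R) (A : V -> 'M[R]_(m, n)) x u :
  differentiable k x -> differentiable A x ->
  'D_u (fun z => k z *: A z) x = 'D_u k x *: A x + k x *: 'D_u A x.
Proof.
move=> dk dA; apply/matrixP => i j.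
rewrite derive_coord; last exact: differentiable_scalef.
have -> : (fun z => (k z *: A z) i j) = (fun z => k z * A z i j).
  by apply/funext => z; rewrite mxE.
rewrite derive_mulf //; last exact: differentiable_entry.
by rewrite !mxE -derive_coord.
Qed.

Lemma differentiable_det n (A : V -> 'M[R]_n) x :
  differentiable A x -> differentiable (fun z => \det (A z)) x.
Proof.
move=> /differentiable_mxP dA; apply: differentiable_sumf => s _.
apply: differentiableM; first exact: differentiable_cst.
exact: differentiable_prodf.
Qed.

(** [invmx] is adjugate over determinant on invertible matrices but returns its argument elsewhere,
    so the formula is used on a neighbourhood where the determinant stays nonzero. Christoffel
    symbols and the tangential projection both contain such an inverse. *)
Lemma differentiable_invmx n (A : V -> 'M[R]_n) x :
  differentiable A x -> A x \in unitmx ->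
  differentiable (fun z => invmx (A z)) x.
Proof.
move=> dA; rewrite unitmxE unitfE => Ax.
have dd := differentiable_det dA.
pose B z := (\det (A z))^-1 *: \adj (A z).
apply: (@near_eq_differentiable _ B).
  have : \forall z \near x, \det (A z) != 0.
    have : {for x, continuous (fun z => \det (A z))}.
      exact: differentiable_continuous.
    move=> /(_ [set r | r != 0]); apply.
    exact: (open_nbhs_nbhs (conj (@open_neq _ 0) Ax)).
  apply: filterS => z Az; by rewrite /B /invmx unitmxE unitfE Az.
apply: differentiable_scalef; first exact: differentiableV.
apply/differentiable_mxP => i j.
have -> : (fun z => (\adj (A z)) i j) = (fun z => cofactor (A z) j i).
  by apply/funext => z; rewrite mxE.
apply: differentiableM; first exact: differentiable_cst.
apply: differentiable_det; apply/differentiable_mxP => k l.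
have -> : (fun z => (row' j (col' i (A z))) k l) =
    (fun z => A z (lift j k) (lift i l)).
  by apply/funext => z; rewrite !mxE.
exact: differentiable_entry.
Qed.

End Calculus.

(** * Symmetry of second derivatives *)

Section Schwarz.
Variables (R : realType) (V : normedModType R).
Implicit Types (f : V -> R) (x u v w : V).

Lemma differentiable_line u w (s : R) : differentiable (fun s : R => s *: u + w) s.
Proof.
apply: (@differentiableD _ _ _ (fun s : R => s *: u) (cst w)).
  exact: differentiableZl.
exact: differentiable_cst.
Qed.

Lemma derive_line u w (s : R) : 'D_1 (fun s : R => s *: u + w) s = u.
Proof.
rewrite deriveE; last exact: differentiable_line.
rewrite (@diffD _ _ _ (fun s : R => s *: u) (cst w)) /=; first last.
- exact: differentiable_cst.
- exact: differentiableZl.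
by rewrite diffZl // diff_cst /= diff_val scale1r addr0.
Qed.

Lemma line_is_derive f u w (s : R) : differentiable f (s *: u + w) ->
  is_derive s 1 (fun s => f (s *: u + w)) ('D_u f (s *: u + w)).
Proof.
move=> df; split.
  apply: diff_derivable.
  exact: (@differentiable_comp _ _ _ _ _ f _ (differentiable_line u w s)).
rewrite (deriveE_comp (1 : R) (differentiable_line u w s)) //.
by rewrite derive_line.
Qed.

(** First-order expansion with an explicit radius, the form in which it is applied to ['D_u f] at
    the two points produced by the mean value theorem. *)
Lemma derive_uniform f x (e : R) : differentiable f x -> 0 < e ->
  \forall d \near 0^'+, forall h, `|h| < d ->
    `|f (h + x) - f x - 'D_h f x| <= e * `|h|.
Proof.
move=> df e0.
have /diff_locallyxP[_ E] := df.
have /funext/eqaddoP/(_ e e0) : forall h,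
    f (h + x) = f x + 'd f x h +o_(h \near (0 : V)) h by [].
move=> /nbhs_normP[d /= d0 dE].
near=> r => h hr.
have := dE h; rewrite /= sub0r normrN => /(_ _)/=.
rewrite !fctE opprD addrA -deriveE//; apply.
by apply: (lt_trans hr); near: r; exact: nbhs_right_lt.
Unshelve. all: by end_near. Qed.

(** For fixed t the second difference is the increment on [0,t] of k(s) = f(su+tv+x) - f(su+x). The
    mean value theorem turns it into t k'(s), and k'(s) is a difference of two values of ['D_u f]
    near [x], which differentiability of ['D_u f] at [x] evaluates as t times the mixed
    derivative. *)
Lemma mixed_difference f x u v (e : R) :
  (\forall z \near x, differentiable f z) -> differentiable ('D_u f) x ->
  0 < e ->
  \forall t \near 0^'+,
    `|f (t *: u + (t *: v + x)) - f (t *: u + x) - f (t *: v + x) + f x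
      - t ^+ 2 * 'D_v ('D_u f) x| <= e * t ^+ 2.
Proof.
move=> df dF e0.
(* The displacements su+tv and su have norm at most t c; the summand 1 keeps c positive. Each
   contributes an error e' t c, so e' = e/(2c) makes the total e t, and the factor t of the mean
   value theorem gives e t^2. *)
pose c := `|u| + `|v| + 1.
have c0 : 0 < c by rewrite ltr_wpDl // addr_ge0.
pose e' := e / (2 * c).
have e'0 : 0 < e' by rewrite divr_gt0 // mulr_gt0.
have [d1 /= d10 H1] := (nbhs_normP _ _).1 df.
near (0 : R)^'+ => d.
have d0 : 0 < d by near: d; exact: nbhs_right_gt.
have Hd : forall h, `|h| < d ->
    `|'D_u f (h + x) - 'D_u f x - 'D_h ('D_u f) x| <= e' * `|h|.
  by near: d; exact: derive_uniform.
have dd1 : d < d1 by near: d; exact: nbhs_right_lt.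
near=> t.
have t0 : 0 < t by near: t; exact: nbhs_right_gt.
have td : t * c < d.
  by rewrite -ltr_pdivlMr //; near: t; apply: nbhs_right_lt; exact: divr_gt0.
have small s : 0 <= s <= t -> `|s *: u + t *: v| <= t * c /\ `|s *: u| <= t * c.
  move=> /andP[s0 st].
  have su : `|s *: u| <= t * `|u| by rewrite normrZ ger0_norm // ler_wpM2r.
  have tv : `|t *: v| = t * `|v| by rewrite normrZ gtr0_norm.
  split; last by apply: (le_trans su); rewrite ler_pM2l // /c -addrA lerDl addr_ge0.
  apply: (le_trans (ler_normD _ _)); rewrite tv /c !mulrDr.
  by rewrite -addrA lerD // lerDl mulr1 ltW.
have near_diff h : `|h| <= t * c -> differentiable f (h + x).
  move=> ht; apply: H1 => /=; rewrite opprD addrCA subrr addr0 normrN.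
  exact: (le_lt_trans ht (lt_trans td dd1)).
pose k (s : R) := f (s *: u + (t *: v + x)) - f (s *: u + x).
pose dk (s : R) := 'D_u f (s *: u + (t *: v + x)) - 'D_u f (s *: u + x).
have kd s : 0 <= s <= t -> is_derive s 1 k (dk s).
  move=> /small[s1 s2]; apply: is_deriveB; apply: line_is_derive.
    by rewrite addrA; exact: near_diff.
  exact: near_diff.
have [||s] := @MVT R k dk 0 t t0.
- by move=> s; rewrite in_itv /= => /andP[/ltW ? /ltW ?]; apply: kd; apply/andP.
- apply: continuous_in_subspaceT => s; rewrite inE /= in_itv /= => /kd ks.
  apply: differentiable_continuous; apply/derivable1_diffP.
  exact: ex_derive.
rewrite in_itv /= => /andP[/ltW s0 /ltW st]; rewrite subr0 => ks.
have /small[s1 s2] : 0 <= s <= t by rewrite s0.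
have -> : f (t *: u + (t *: v + x)) - f (t *: u + x) - f (t *: v + x) + f x =
    k t - k 0.
  by rewrite /k !scale0r !add0r; ring.
have h1 := Hd _ (le_lt_trans s1 td).
have h2 := Hd _ (le_lt_trans s2 td).
have lin : 'D_(s *: u + t *: v) ('D_u f) x - 'D_(s *: u) ('D_u f) x =
    t * 'D_v ('D_u f) x.
  by rewrite !deriveE // linearD [LHS]addrC addKr linearZ.
rewrite ks /dk.
have -> : e * t ^+ 2 = (e' * (t * c) + e' * (t * c)) * t.
  by rewrite /e'; field; rewrite gt_eqF.
rewrite expr2 -mulrA [X in X - _]mulrC -mulrBr normrM (gtr0_norm t0) mulrC.
rewrite ler_pM2r // -lin.
have split5 (a b p q r : R) : a - b - (p - q) = (a - r - p) - (b - r - q).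
  by ring.
rewrite (split5 _ _ _ _ ('D_u f x)).
rewrite addrA; apply: (le_trans (ler_normB _ _)).
by apply: lerD; [apply: (le_trans h1)|apply: (le_trans h2)]; rewrite ler_pM2l.
Unshelve. all: by end_near. Qed.

(** The second difference is symmetric in [u] and [v], so t^2 times either mixed derivative lies
    within (e/2) t^2 of the same number. *)
Lemma derive_commf f x u v : (\forall z \near x, differentiable f z) ->
  differentiable ('D_u f) x -> differentiable ('D_v f) x ->
  'D_v ('D_u f) x = 'D_u ('D_v f) x.
Proof.
move=> df du dv; apply/eqP; rewrite -subr_eq0 -normr_le0.
apply/ler_addgt0Pl => e e0; rewrite addr0.
have e20 : 0 < e / 2 by rewrite divr_gt0.
have H1 := mixed_difference v df du e20.
have H2 := mixed_difference u df dv e20.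
have [t [[h1 h2] t0]] := filter_ex (filterI (filterI H1 H2)
  (nbhs_right_gt (0 : R))).
have t20 : 0 < t ^+ 2 by rewrite exprn_gt0.
rewrite -(ler_pM2r t20) -{1}(gtr0_norm t20) -normrM mulrC mulrBr.
rewrite [e]splitr mulrDl.
move: h1 h2; rewrite [t *: v + (t *: u + x)]addrCA.
rewrite [_ - f (t *: v + x) - f (t *: u + x)]addrAC.
set D := _ - _ - _ + _ => h1 h2.
have split3 (a b : R) : a - b = (D - b) - (D - a) by ring.
rewrite split3.
exact: (le_trans (ler_normB _ _) (lerD h2 h1)).
Qed.

Lemma derive_comm m n (A : V -> 'M[R]_(m, n)) x u v :
  (\forall z \near x, differentiable A z) ->
  differentiable ('D_u A) x -> differentiable ('D_v A) x ->
  'D_v ('D_u A) x = 'D_u ('D_v A) x.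
Proof.
move=> dA du dv; apply/matrixP => i j.
apply: (etrans (derive_coord v i j du)).
apply: etrans _ (esym (derive_coord u i j dv)).
have E w : \forall z \near x, ('D_w A z) i j = 'D_w (fun z => A z i j) z.
  by apply: filterS dA => z dz; exact: derive_coord.
apply: (etrans (near_eq_derive v (E u))).
apply: etrans _ (esym (near_eq_derive u (E v))).
apply: derive_commf.
- by apply: filterS dA => z dz; exact: differentiable_entry.
- exact: near_eq_differentiable (E u) (differentiable_entry i j du).
- exact: near_eq_differentiable (E v) (differentiable_entry i j dv).
Qed.

End Schwarz.

(** * Bilinear forms in coordinates *)

Section Inner.
Variables (R : realType) (d : nat).
Implicit Types (G : 'M[R]_d) (u v w : 'rV[R]_d) (k : R).

Lemma innerDl G u v w : inner G (u + v) w = inner G u w + inner G v w.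
Proof. by rewrite /inner !mulmxDl mxE. Qed.

Lemma innerDr G u v w : inner G w (u + v) = inner G w u + inner G w v.
Proof. by rewrite /inner linearD mulmxDr mxE. Qed.

Lemma innerZl G k u v : inner G (k *: u) v = k * inner G u v.
Proof. by rewrite /inner -!scalemxAl mxE. Qed.

Lemma innerZr G k u v : inner G u (k *: v) = k * inner G u v.
Proof. by rewrite /inner linearZ -scalemxAr mxE. Qed.

Lemma innerNl G u v : inner G (- u) v = - inner G u v.
Proof. by rewrite -scaleN1r innerZl mulN1r. Qed.

Lemma innerNr G u v : inner G u (- v) = - inner G u v.
Proof. by rewrite -scaleN1r innerZr mulN1r. Qed.

Lemma inner0l G v : inner G 0 v = 0.
Proof. by rewrite /inner !mul0mx mxE. Qed.

Lemma inner0r G v : inner G v 0 = 0.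
Proof. by rewrite /inner linear0 mulmx0 mxE. Qed.

Lemma inner_suml G (I : finType) (F : I -> 'rV[R]_d) v :
  inner G (\sum_i F i) v = \sum_i inner G (F i) v.
Proof. by rewrite /inner !mulmx_suml summxE. Qed.

Lemma inner_sumr G (I : finType) (F : I -> 'rV[R]_d) v :
  inner G v (\sum_i F i) = \sum_i inner G v (F i).
Proof. by rewrite /inner linear_sum mulmx_sumr summxE. Qed.

Lemma inner_mxD G1 G2 u v : inner (G1 + G2) u v = inner G1 u v + inner G2 u v.
Proof. by rewrite /inner mulmxDr mulmxDl mxE. Qed.

Lemma inner_mxZ k G u v : inner (k *: G) u v = k * inner G u v.
Proof. by rewrite /inner -scalemxAr -scalemxAl mxE. Qed.

Lemma inner_mx_sum (I : finType) (F : I -> 'M[R]_d) u v :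
  inner (\sum_i F i) u v = \sum_i inner (F i) u v.
Proof. by rewrite /inner mulmx_sumr mulmx_suml summxE. Qed.

Definition innerE := (innerDl, innerDr, innerZl, innerZr, innerNl, innerNr,
  inner0l, inner0r).

Lemma inner_tr G u v : inner G^T u v = inner G v u.
Proof.
rewrite /inner; transitivity ((v *m G *m u^T)^T 0 0); last by rewrite mxE.
by rewrite !trmx_mul trmxK mulmxA.
Qed.

Lemma inner_sym G u v : G^T = G -> inner G u v = inner G v u.
Proof. by move=> GT; rewrite -{1}GT inner_tr. Qed.

Lemma inner_inj G u v : G \in unitmx ->
  (forall w, inner G u w = inner G v w) -> u = v.
Proof.
move=> Gu uv; apply: (can_inj (mulmxK Gu)); apply/rowP => i.
have := uv (delta_mx 0 i).
by rewrite /inner trmx_delta -!colE !mxE.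
Qed.

Lemma posdef_unitmx G : (forall u, u != 0 -> 0 < inner G u u) -> G \in unitmx.
Proof.
move=> Gpos; rewrite -row_free_unit; apply: inj_row_free => u uG.
apply/eqP/negP => /negP/Gpos.
by rewrite /inner uG mul0mx mxE ltxx.
Qed.

Lemma inner_mul_inv G (r w : 'rV[R]_d) : G \in unitmx ->
  inner G (r *m invmx G) w = \sum_k r 0 k * w 0 k.
Proof.
move=> Gu; rewrite /inner mulmxKV // mxE.
by apply: eq_bigr => k _; rewrite mxE.
Qed.

Lemma inner_congr n (J : 'M[R]_(n, d)) G (u v : 'rV[R]_n) :
  inner (J *m G *m J^T) u v = inner G (u *m J) (v *m J).
Proof. by rewrite /inner trmx_mul !mulmxA. Qed.

Lemma inner_proj n (J : 'M[R]_(n, d)) G (M : 'M[R]_n) (w : 'rV[R]_d)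
    (u : 'rV[R]_n) :
  M \in unitmx ->
  inner M (w *m G *m J^T *m invmx M) u = inner G w (u *m J).
Proof. by move=> Mu; rewrite /inner mulmxKV // trmx_mul !mulmxA. Qed.

Lemma inner_row n G (B : 'M[R]_(n, d)) w i :
  (w *m (G *m B^T)) 0 i = inner G w (row i B).
Proof.
rewrite /inner mulmxA !mxE; apply: eq_bigr => j _.
by rewrite !mxE.
Qed.

End Inner.

Lemma linear_at0 (R : realType) (V W : lmodType R) (L : V -> W) :
  linear L -> L 0 = 0.
Proof.
by move=> /(_ (-1) 0 0); rewrite scaler0 addr0 => ->; rewrite scaleN1r addNr.
Qed.

Lemma linear_expand (R : realType) (d : nat) (W : lmodType R)
    (L : 'rV[R]_d -> W) (v : 'rV[R]_d) : linear L ->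
  L v = \sum_i v 0 i *: L (delta_mx 0 i).
Proof.
move=> Llin; pose L' : {linear 'rV[R]_d -> W} :=
  HB.pack L (GRing.isLinear.Build _ _ _ _ _ Llin).
rewrite {1}(row_sum_delta v) -[L]/(L' : _ -> _) linear_sum.
by apply: eq_bigr => i _; rewrite linearZ.
Qed.

Section SmoothOn.
Variables (R : realType) (d : nat) (W : normedModType R).
Implicit Types (U : set 'rV[R]_d) (f : 'rV[R]_d -> W).

Lemma smooth_differentiable U f x : smooth_on U f -> U x -> differentiable f x.
Proof. by move=> sf; exact: (sf [::] x). Qed.

Lemma smooth_derive U f v : smooth_on U f -> smooth_on U ('D_v f).
Proof. by move=> sf s x Ux; have := sf (rcons s v) x Ux; rewrite foldr_rcons. Qed.

Lemma open_near U x : open U -> U x -> \forall z \near x, U z.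
Proof. by move=> oU Ux; exact: (open_nbhs_nbhs (conj oU Ux)). Qed.

End SmoothOn.

Section DeriveInner.
Variables (R : realType) (V : normedModType R) (d : nat).
Variables (A : V -> 'M[R]_d) (X Y : V -> 'rV[R]_d) (x : V).
Hypotheses (dA : differentiable A x) (dX : differentiable X x).
Hypothesis (dY : differentiable Y x).

Lemma differentiable_inner : differentiable (fun z => inner (A z) (X z) (Y z)) x.
Proof.
apply: differentiable_entry; apply: differentiable_mulmx.
  exact: differentiable_mulmx.
exact: differentiable_tr.
Qed.

Lemma derive_inner u :
  'D_u (fun z => inner (A z) (X z) (Y z)) x =
  inner ('D_u A x) (X x) (Y x) + inner (A x) ('D_u X x) (Y x)
  + inner (A x) (X x) ('D_u Y x).
Proof.
have dXA := differentiable_mulmx dX dA; have dYT := differentiable_tr dY.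
rewrite -(derive_coord u 0 0 (differentiable_mulmx dXA dYT)).
rewrite (derive_mulmx dXA dYT) (derive_mulmx dX dA) (derive_tr _ dY).
by rewrite mulmxDl !mxE -/(inner _ _ _) /inner !mxE; congr (_ + _); rewrite addrC.
Qed.

End DeriveInner.

Section BilinearField.
Variables (R : realType) (V : normedModType R) (d e : nat).
Variables (B : 'rV[R]_d -> 'rV[R]_d -> 'rV[R]_d -> 'rV[R]_e).
Variables (O : set 'rV[R]_d).
Hypotheses (Bl : forall p v, O p -> linear (fun u => B p u v))
  (Br : forall p u, O p -> linear (B p u)).
Variables (f X Y : V -> 'rV[R]_d) (x : V).
Hypotheses (oO : open O) (Ofx : O (f x)) (df : differentiable f x).
Hypotheses (dX : differentiable X x) (dY : differentiable Y x).
Hypothesis dB : forall u v, differentiable (fun p => B p u v) (f x).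

Let T i j z := (X z 0 i * Y z 0 j) *:
  B (f z) (delta_mx 0 i) (delta_mx 0 j).

Let BE p u v : O p -> B p u v =
  \sum_i \sum_j (u 0 i * v 0 j) *: B p (delta_mx 0 i) (delta_mx 0 j).
Proof.
move=> Op; rewrite (linear_expand u (Bl v Op)); apply: eq_bigr => i _.
rewrite (linear_expand v (Br _ Op)) scaler_sumr.
by apply: eq_bigr => j _; rewrite scalerA.
Qed.

Let near_BE :
  \forall z \near x, \sum_i \sum_j T i j z = B (f z) (X z) (Y z).
Proof.
have : \forall z \near x, O (f z).
  exact: (differentiable_continuous df (open_near oO Ofx)).
by apply: filterS => z Oz; rewrite -BE.
Qed.

Let dBf i j :
  differentiable (fun z => B (f z) (delta_mx 0 i) (delta_mx 0 j)) x.
Proof. exact: (@differentiable_comp _ _ _ _ f (fun p => B p _ _) x df). Qed.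

Let dXY i j : differentiable (fun z => X z 0 i * Y z 0 j) x.
Proof.
exact: (differentiableM (differentiable_entry 0 i dX)
                        (differentiable_entry 0 j dY)).
Qed.

Let dT i j : differentiable (T i j) x.
Proof. exact: (differentiable_scalef (dXY i j) (dBf i j)). Qed.

Lemma differentiable_bilinear_field :
  differentiable (fun z => B (f z) (X z) (Y z)) x.
Proof.
apply: near_eq_differentiable near_BE _.
by apply: differentiable_sumf => i _; apply: differentiable_sumf => j _.
Qed.

(** Product rule for Christoffel symbols along an immersion: the terms come from the base point and
    from the two arguments. Bilinearity holds only on [O], so the coordinate expansion is an
    identity near the point. *)
Lemma derive_bilinear_field u :
  'D_u (fun z => B (f z) (X z) (Y z)) x =
  'D_('D_u f x) (fun p => B p (X x) (Y x)) (f x)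
  + B (f x) ('D_u X x) (Y x) + B (f x) (X x) ('D_u Y x).
Proof.
rewrite -(near_eq_derive u near_BE).
rewrite derive_sumf; last by move=> i; exact: differentiable_sumf.
have -> : 'D_('D_u f x) (fun p => B p (X x) (Y x)) (f x) =
    \sum_i \sum_j (X x 0 i * Y x 0 j) *:
      'D_('D_u f x) (fun p => B p (delta_mx 0 i) (delta_mx 0 j)) (f x).
  have E : \forall p \near f x, \sum_i \sum_j (X x 0 i * Y x 0 j) *:
      B p (delta_mx 0 i) (delta_mx 0 j) = B p (X x) (Y x).
    by apply: filterS (open_near oO Ofx) => p Op; rewrite -BE.
  have dc i j : differentiable (cst (X x 0 i * Y x 0 j)) (f x).
    exact: differentiable_cst.
  rewrite -(near_eq_derive _ E) derive_sumf; last first.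
    move=> i; apply: differentiable_sumf => j _.
    exact: (differentiable_scalef (dc i j)).
  apply: eq_bigr => i _; rewrite derive_sumf; last first.
    by move=> j; exact: (differentiable_scalef (dc i j)).
  apply: eq_bigr => j _.
  by rewrite (derive_scalef _ (dc i j) (dB _ _)) derive_cst scale0r add0r.
rewrite !BE // -!big_split; apply: eq_bigr => i _.
rewrite derive_sumf // -!big_split; apply: eq_bigr => j _ /=.
rewrite (derive_scalef _ (dXY i j) (dBf i j)).
rewrite (derive_mulf _ (differentiable_entry 0 i dX) (differentiable_entry 0 j dY)).
rewrite (deriveE_comp u df (dB _ _)) -!derive_coord //.
rewrite addrC scalerDl [X in X + _ = _]addrC -addrA.
by congr (_ + _); rewrite addrC.
Qed.

End BilinearField.

(** * Symmetry of h' and phi h' *)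

Section ContactAlgebra.
Variables (R : realType) (d : nat) (G phi J phi' G' : 'M[R]_d).
Variables (xi : 'rV[R]_d) (eta : 'rV[R]_d -> R).
Implicit Types u v : 'rV[R]_d.
Hypotheses (Gsym : forall u v, inner G u v = inner G v u).
Hypotheses (G'sym : forall u v, inner G' u v = inner G' v u).
Hypothesis skew : forall u v, inner G u (v *m phi) = - inner G (u *m phi) v.
Hypothesis phi2 : forall u, u *m phi *m phi = - u + eta u *: xi.
Hypothesis dual : forall u, inner G u xi = eta u.
(* [J] is the Jacobian of [xi] and primes are derivatives along [xi]; the
   hypotheses are the Lie derivatives along [xi] of [g (-, phi -) = d eta], of
   [g (-, xi) = eta] and of [phi2], with [L_xi eta = 0]. *)
Hypothesis Lie_Phi : forall u v,
  inner G' u (v *m phi) + inner G u (v *m phi') + inner G (u *m J) (v *m phi)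
  + inner G u (v *m J *m phi) = 0.
Hypothesis Lie_dual : forall u,
  inner G' u xi + inner G u (xi *m J) = - eta (u *m J).
Hypothesis Lie_phi2 : forall u,
  u *m phi' *m phi + u *m phi *m phi' =
  - eta (u *m J) *: xi + eta u *: (xi *m J).

(** [T] is the Lie derivative of phi along xi, that is 2h', and [S] is the Lie derivative of the
    metric, both on vectors extended to constant fields. *)
Let T u := u *m phi' - u *m phi *m J + u *m J *m phi.
Let S u v := inner G' u v + inner G (u *m J) v + inner G u (v *m J).

Let S_sym u v : S u v = S v u.
Proof. by rewrite /S (G'sym u) (Gsym u) (Gsym _ v); ring. Qed.

Let S_lin u v k w : S u (- v + k *: w) = - S u v + k * S u w.
Proof. by rewrite /S !mulmxDl !mulNmx -!scalemxAl !innerE; ring. Qed.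

(** As d eta is invariant along xi, so is g(-, phi -); the Leibniz rule then trades the derivative
    of [g] for that of phi. *)
Let S_phi u v : S u (v *m phi) = - inner G u (T v).
Proof. by have := Lie_Phi u v; rewrite /S /T !innerE; lra. Qed.

Let S_xi u : S u xi = 0.
Proof. by have := Lie_dual u; rewrite /S dual; lra. Qed.

(** The Lie derivative of phi^2 = -1 + eta xi vanishes because eta and xi are invariant along xi;
    hence that of phi anticommutes with phi. *)
Let T_phi v : T v *m phi = - T (v *m phi).
Proof.
have E := Lie_phi2 v.
rewrite /T !(mulmxDl, mulNmx) !phi2 !(mulmxDl, mulNmx) -scalemxAl.
move: (v *m phi' *m phi) (v *m phi *m phi') (v *m J) (xi *m J) E
  => a b p q /(canRL (addKr _)) ->.
by apply/rowP => i; rewrite !mxE; ring.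
Qed.

Let T_skew u v : inner G u (T v *m phi) = S (u *m phi) (v *m phi).
Proof. by rewrite S_phi skew. Qed.

Let S_phi2 u v : S (u *m phi) (v *m phi) = - S u v.
Proof.
by rewrite -T_skew T_phi innerNr -S_phi phi2 S_lin S_xi mulr0 addr0.
Qed.

(** By [T_phi], [S] changes sign when phi is applied to both arguments; since xi is in its kernel,
    phi can then be moved from one argument of [S] to the other. So g(u, T v) = -S(u, phi v)
    inherits the symmetry of [S]. *)
Lemma lie_endo_sym u v : inner G u (T v) = inner G (T u) v.
Proof.
have S_phi_sym a c : S (a *m phi) c = S a (c *m phi).
  have := S_phi2 a (c *m phi); rewrite phi2 S_lin S_xi mulr0 addr0.
  exact: oppr_inj.
by rewrite [RHS]Gsym -[LHS]opprK -[RHS]opprK -!S_phi -S_phi_sym S_sym.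
Qed.

(** Both sides reduce to S(phi u, phi v), up to exchanging [u] and [v]. *)
Lemma lie_endo_phi_sym u v :
  inner G u (T v *m phi) = inner G (T u *m phi) v.
Proof. by rewrite [RHS]Gsym !T_skew S_sym. Qed.

End ContactAlgebra.

Section ContactMetric.
Variables (R : realType) (d : nat) (O : set 'rV[R]_d).
Variables (g phi : 'rV[R]_d -> 'M[R]_d).
Variables (xi : 'rV[R]_d -> 'rV[R]_d) (eta : 'rV[R]_d -> 'cV[R]_d).
Hypotheses (oO : open O) (sg : smooth_on O g) (sphi : smooth_on O phi).
Hypotheses (sxi : smooth_on O xi) (seta : smooth_on O eta).
Hypothesis gsym : forall x, O x -> (g x)^T = g x.
Hypothesis phi2 : forall x u, O x ->
  u *m phi x *m phi x = - u + ev1 (eta x) u *: xi x.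
Hypothesis eta_xi : forall x, O x -> ev1 (eta x) (xi x) = 1.
Hypothesis phi_xi : forall x, O x -> xi x *m phi x = 0.
Hypothesis skew : forall x u v, O x ->
  inner (g x) u (v *m phi x) = - inner (g x) (u *m phi x) v.
Hypothesis dual : forall x u, O x -> inner (g x) u (xi x) = ev1 (eta x) u.
Hypothesis contact : forall x u v, O x ->
  inner (g x) u (v *m phi x) = d_one_form eta (cst u) (cst v) x.
Variable p : 'rV[R]_d.
Hypothesis Op : O p.

(* Comparing two terms ['D_u f x] and ['D_v f x] makes Rocq unfold limits, so
   derivatives that enter computations are given names. *)
Variables (De : 'rV[R]_d -> 'rV[R]_d -> 'cV[R]_d).
Variables (Dx : 'rV[R]_d -> 'rV[R]_d -> 'rV[R]_d).
Variables (DDe : 'rV[R]_d -> 'rV[R]_d -> 'cV[R]_d).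
Variables (DDx : 'rV[R]_d -> 'rV[R]_d -> 'rV[R]_d).
Hypotheses (DeE : forall u x, 'D_u eta x = De u x).
Hypotheses (DxE : forall u x, 'D_u xi x = Dx u x).
Hypotheses (DDeE : forall u v, 'D_u (De v) p = DDe u v).
Hypotheses (DDxE : forall u v, 'D_u (Dx v) p = DDx u v).
Implicit Types u v w z : 'rV[R]_d.

Let dp (A : normedModType R) (f : 'rV[R]_d -> A) x :
  smooth_on O f -> O x -> differentiable f x.
Proof. exact: smooth_differentiable. Qed.

Let DeF u : De u = 'D_u eta.
Proof. by apply/funext => x; rewrite DeE. Qed.

Let DxF u : Dx u = 'D_u xi.
Proof. by apply/funext => x; rewrite DxE. Qed.

Let dDe u x : O x -> differentiable (De u) x.
Proof. by rewrite DeF; apply/dp/smooth_derive. Qed.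

Let dDx u x : O x -> differentiable (Dx u) x.
Proof. by rewrite DxF; apply/dp/smooth_derive. Qed.

Let DDeC u v : DDe u v = DDe v u.
Proof.
have Pd : \forall z \near p, differentiable eta z.
  by apply: filterS (open_near oO Op) => z; exact: dp.
by rewrite -!DDeE !DeF; apply: derive_comm Pd _ _; rewrite -DeF; exact: dDe.
Qed.

Let DDxC u v : DDx u v = DDx v u.
Proof.
have Pd : \forall z \near p, differentiable xi z.
  by apply: filterS (open_near oO Op) => z; exact: dp.
by rewrite -!DDxE !DxF; apply: derive_comm Pd _ _; rewrite -DxF; exact: dDx.
Qed.

(** Matrix of (u, v) -> (D_u eta)(v). Its skew part is d eta, and as a matrix it can be
    differentiated by the rules for [inner]. *)
Let K x : 'M[R]_d := \matrix_(i, j) De (delta_mx 0 i) x j 0.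

Let De_lin x : O x -> linear (fun u => De u x).
Proof. by move=> /(dp seta) de k u v; rewrite -!DeE !deriveE // linearP. Qed.

Let KE x u v : O x -> inner (K x) u v = ev1 (De u x) v.
Proof.
move=> Ox; rewrite /inner /ev1.
have -> : u *m K x = (De u x)^T.
  apply/rowP => j; rewrite (linear_expand u (De_lin Ox)) !mxE summxE.
  by apply: eq_bigr => i _; rewrite !mxE.
by rewrite -trmx_mul mxE.
Qed.

Let dK x : O x -> differentiable K x.
Proof.
move=> Ox; apply/differentiable_mxP => i j.
have -> : (fun z => K z i j) = (fun z => De (delta_mx 0 i) z j 0).
  by apply/funext => z; rewrite mxE.
exact: differentiable_entry (dDe _ Ox).
Qed.

Let d_ev1 (w : 'rV[R]_d -> 'cV[R]_d) (X : 'rV[R]_d -> 'rV[R]_d) u x :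
  differentiable w x -> differentiable X x ->
  'D_u (fun z => ev1 (w z) (X z)) x =
  ev1 ('D_u w x) (X x) + ev1 (w x) ('D_u X x).
Proof.
move=> dw dX; rewrite -(derive_coord u 0 0 (differentiable_mulmx dX dw)).
by rewrite (derive_mulmx dX dw) mxE addrC.
Qed.

Let ev1r0 (w : 'cV[R]_d) : ev1 w 0 = 0.
Proof. by rewrite /ev1 mul0mx mxE. Qed.

Let dKE u v w : inner ('D_w K p) u v = ev1 (DDe w u) v.
Proof.
have dc (c : 'rV[R]_d) := differentiable_cst c p.
have E : \forall z \near p, inner (K z) u v = ev1 (De u z) v.
  by apply: filterS (open_near oO Op) => z Oz; rewrite KE.
have := near_eq_derive w E.
rewrite (derive_inner (dK Op) (dc u) (dc v)) (d_ev1 w (dDe u Op) (dc v)).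
rewrite !derive_cst !inner0l inner0r !addr0 DDeE => ->.
by rewrite ev1r0 addr0.
Qed.

Let contact_K x u v : O x ->
  inner (g x) u (v *m phi x) = 2^-1 * (inner (K x) u v - inner (K x) v u).
Proof.
move=> Ox; rewrite contact // /d_one_form /bracket !derive_cst subrr.
have dc (c : 'rV[R]_d) := differentiable_cst c x.
rewrite (d_ev1 _ (dp seta Ox) (dc v)) (d_ev1 _ (dp seta Ox) (dc u)).
by rewrite !derive_cst !DeE !KE // !ev1r0 subr0 !addr0.
Qed.

(** This is L_xi eta = 0: the contact condition and phi xi = 0 give K(v, xi) = K(xi, v), and the
    former is found by differentiating eta(xi) = 1 along [v]. *)
Let Lie_eta x v : O x ->
  inner (K x) (xi x) v + ev1 (eta x) (Dx v x) = 0.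
Proof.
move=> Ox.
have E : \forall z \near x, ev1 (eta z) (xi z) = 1.
  by apply: filterS (open_near oO Ox) => z Oz; exact: eta_xi.
have := near_eq_derive v E.
rewrite derive_cst (d_ev1 v (dp seta Ox) (dp sxi Ox)) DeE DxE -KE // => {}E.
have := contact_K v (xi x) Ox; rewrite phi_xi // inner0r; lra.
Qed.

(** This is L_xi d eta = d L_xi eta = 0, obtained by differentiating [Lie_eta] and antisymmetrizing;
    the second derivatives of xi are symmetric and drop out. *)
Let Lie_deta u v :
  ev1 (DDe (xi p) u) v - ev1 (DDe (xi p) v) u
  + inner (K p) (Dx u p) v - inner (K p) v (Dx u p)
  + inner (K p) u (Dx v p) - inner (K p) (Dx v p) u = 0.
Proof.
have dLie a c : ev1 (DDe (xi p) a) c + inner (K p) (Dx a p) c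
    + inner (K p) a (Dx c p) + ev1 (eta p) (DDx a c) = 0.
  have E : \forall z \near p,
      inner (K z) (xi z) c + ev1 (eta z) (Dx c z) = 0.
    by apply: filterS (open_near oO Op) => z; exact: Lie_eta.
  have dc := differentiable_cst c p.
  have d1 := differentiable_inner (dK Op) (dp sxi Op) dc.
  have d2 : differentiable (fun z => ev1 (eta z) (Dx c z)) p.
    exact: differentiable_entry
      (differentiable_mulmx (dDx c Op) (dp seta Op)).
  have := near_eq_derive a E; rewrite derive_cst.
  rewrite (derive_addf a d1 d2).
  rewrite (derive_inner (dK Op) (dp sxi Op) dc) derive_cst inner0r addr0.
  rewrite (d_ev1 a (dp seta Op) (dDx c Op)) dKE DDeC DxE DeE DDxE.
  by rewrite -[ev1 (De a p) _]KE // => <-; rewrite !addrA.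
have := dLie u v; have := dLie v u; rewrite (DDxC v u); lra.
Qed.

Variables (phi' g' : 'M[R]_d).
Hypotheses (phi'E : 'D_(xi p) phi p = phi') (g'E : 'D_(xi p) g p = g').
Let J := jacobian xi p.

Let JE u : u *m J = Dx u p.
Proof. by rewrite /J -deriveEjacobian ?DxE //; exact: dp. Qed.

Let Lie_g_sym u v : inner g' u v = inner g' v u.
Proof.
apply: inner_sym; rewrite -g'E -(derive_tr _ (dp sg Op)).
by apply: near_eq_derive; exact: filterS (open_near oO Op).
Qed.

Let Lie_Phi u v :
  inner g' u (v *m phi p) + inner (g p) u (v *m phi')
  + inner (g p) (u *m J) (v *m phi p)
  + inner (g p) u (v *m J *m phi p) = 0.
Proof.
have E : \forall z \near p, inner (g z) u (v *m phi z) =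
    2^-1 * (inner (K z) u v - inner (K z) v u).
  by apply: filterS (open_near oO Op) => z; exact: contact_K.
have dc (c : 'rV[R]_d) := differentiable_cst c p.
have dvp := differentiable_mulmx (dc v) (dp sphi Op).
have dK1 := differentiable_inner (dK Op) (dc u) (dc v).
have dK2 := differentiable_inner (dK Op) (dc v) (dc u).
have := near_eq_derive (xi p) E.
rewrite (derive_inner (dp sg Op) (dc u) dvp) derive_cst inner0l addr0.
rewrite (derive_mulmx (dc v) (dp sphi Op)) derive_cst mul0mx add0r phi'E g'E.
rewrite (derive_mulcf _ _ (differentiableB dK1 dK2)) (derive_subf _ dK1 dK2).
rewrite (derive_inner (dK Op) (dc u) (dc v)).
rewrite (derive_inner (dK Op) (dc v) (dc u)).
rewrite !derive_cst !inner0l !inner0r !addr0 !dKE !JE !contact_K //.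
by have := Lie_deta u v; lra.
Qed.

Let Lie_dual u :
  inner g' u (xi p) + inner (g p) u (xi p *m J) = - ev1 (eta p) (u *m J).
Proof.
have E : \forall z \near p, inner (g z) u (xi z) = ev1 (eta z) u.
  by apply: filterS (open_near oO Op) => z; exact: dual.
have dc (c : 'rV[R]_d) := differentiable_cst c p.
have := near_eq_derive (xi p) E.
rewrite (derive_inner (dp sg Op) (dc u) (dp sxi Op)) (d_ev1 _ (dp seta Op) (dc u)).
rewrite !derive_cst inner0l ev1r0 !addr0 g'E DxE DeE !JE => ->.
by rewrite -KE //; have := Lie_eta u Op; lra.
Qed.

Let Lie_phi2 u :
  u *m phi' *m phi p + u *m phi p *m phi' =
  - ev1 (eta p) (u *m J) *: xi p + ev1 (eta p) u *: (xi p *m J).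
Proof.
have E : \forall z \near p,
    u *m phi z *m phi z = - u + ev1 (eta z) u *: xi z.
  by apply: filterS (open_near oO Op) => z; exact: phi2.
have dc (c : 'rV[R]_d) := differentiable_cst c p.
have dup := differentiable_mulmx (dc u) (dp sphi Op).
have deu : differentiable (fun z => ev1 (eta z) u) p.
  exact: differentiable_entry (differentiable_mulmx (dc u) (dp seta Op)).
have dex := differentiable_scalef deu (dp sxi Op).
have := near_eq_derive (xi p) E.
rewrite (derive_mulmx dup (dp sphi Op)) (derive_mulmx (dc u) (dp sphi Op)).
rewrite (derive_addf _ (dc (- u)) dex).
rewrite (derive_scalef _ deu (dp sxi Op)) (d_ev1 _ (dp seta Op) (dc u)).
rewrite !derive_cst mul0mx ev1r0 !add0r addr0 phi'E DeE DxE => ->.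
rewrite -KE // JE -(JE (xi p)); congr (_ *: _ + _).
by have := Lie_eta u Op; lra.
Qed.

Let bracket_cst u : bracket xi (cst u) p = - (u *m J).
Proof. by rewrite /bracket derive_cst sub0r DxE JE. Qed.

Lemma hprimeE u :
  hprime phi xi p u = 2^-1 *: (u *m phi' - u *m phi p *m J + u *m J *m phi p).
Proof.
have dc (c : 'rV[R]_d) := differentiable_cst c p.
rewrite /hprime /lie_endo bracket_cst mulNmx opprK; congr (_ *: (_ + _)).
rewrite /bracket (derive_mulmx (dc u) (dp sphi Op)) derive_cst mul0mx add0r.
by rewrite DxE phi'E JE.
Qed.

Lemma hprime_lin : linear (hprime phi xi p).
Proof.
by move=> k u v; rewrite !hprimeE !mulmxDl -!scalemxAl; apply/rowP => i;
   rewrite !mxE; ring.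
Qed.

Lemma hprime_sym u v :
  inner (g p) u (hprime phi xi p v) = inner (g p) (hprime phi xi p u) v.
Proof.
rewrite !hprimeE innerZl innerZr; congr (_ * _).
apply: (@lie_endo_sym _ _ (g p) (phi p) J phi' g' (xi p) (ev1 (eta p))) => //.
- by move=> *; apply: inner_sym; exact: gsym.
- by move=> *; exact: skew.
- by move=> *; exact: phi2.
- by move=> *; exact: dual.
Qed.

Lemma hprime_phi_sym u v :
  inner (g p) u (hprime phi xi p v *m phi p) =
  inner (g p) (hprime phi xi p u *m phi p) v.
Proof.
rewrite !hprimeE -!scalemxAl innerZl innerZr; congr (_ * _).
apply: (@lie_endo_phi_sym _ _ (g p) (phi p) J phi' g') => //.
- by move=> *; apply: inner_sym; exact: gsym.
- by move=> *; exact: skew.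
Qed.

End ContactMetric.

(** * Christoffel symbols *)

Local Opaque inner.

Section Christoffel.
Variables (R : realType) (d : nat) (O : set 'rV[R]_d) (g : 'rV[R]_d -> 'M[R]_d).
Variable Dg : 'rV[R]_d -> 'rV[R]_d -> 'M[R]_d.
Hypotheses (oO : open O) (sg : smooth_on O g).
Hypothesis DgE : forall x u, 'D_u g x = Dg x u.
Hypothesis gsym : forall x, O x -> (g x)^T = g x.
Hypothesis gpos : forall x u, O x -> u != 0 -> 0 < inner (g x) u u.
Implicit Types (x u v w : 'rV[R]_d).

Let dg x : O x -> differentiable g x.
Proof. exact: smooth_differentiable. Qed.

Let dDg x u : O x -> differentiable (Dg^~ u) x.
Proof.
have -> : Dg^~ u = 'D_u g by apply/funext => z; rewrite DgE.
exact/smooth_differentiable/smooth_derive.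
Qed.

Let gunit x : O x -> g x \in unitmx.
Proof. by move=> Ox; apply: posdef_unitmx => u; exact: gpos. Qed.

Lemma derive_metric_lin x : O x -> linear (Dg x).
Proof. by move=> /dg dgx k u v; rewrite -!DgE !deriveE // linearP. Qed.

Lemma derive_metric_sym x u v w : O x ->
  inner (Dg x u) v w = inner (Dg x u) w v.
Proof.
move=> Ox; apply: inner_sym; rewrite -DgE -(derive_tr u (dg Ox)).
by apply: near_eq_derive; exact: filterS (open_near oO Ox).
Qed.

Lemma derive_metric_cst x u v w : O x ->
  'D_u (fun z => inner (g z) v w) x = inner (Dg x u) v w.
Proof.
move=> Ox; have dc (c : 'rV[R]_d) := differentiable_cst c x.
rewrite (derive_inner (dg Ox) (dc v) (dc w)) !derive_cst DgE.
by rewrite inner0l inner0r !addr0.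
Qed.

(** The definition prescribes the products with coordinate vectors only; linearity in the direction
    of differentiation extends the formula to every [w]. *)
Lemma christoffelE x u v w : O x ->
  inner (g x) (christoffel g x u v) w =
  2^-1 * (inner (Dg x u) v w + inner (Dg x v) u w - inner (Dg x w) u v).
Proof.
move=> Ox; rewrite (inner_mul_inv _ _ (gunit Ox)).
have Er G a : inner G a w = \sum_k w 0 k * inner G a (delta_mx 0 k).
  rewrite {1}[w]row_sum_delta inner_sumr.
  by apply: eq_bigr => k _; rewrite innerZr.
have Ew : inner (Dg x w) u v =
    \sum_k w 0 k * inner (Dg x (delta_mx 0 k)) u v.
  rewrite (linear_expand w (derive_metric_lin Ox)) inner_mx_sum.
  by apply: eq_bigr => k _; rewrite inner_mxZ.
rewrite (Er (Dg x u)) (Er (Dg x v)) Ew -big_split -sumrB mulr_sumr.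
by apply: eq_bigr => k _; rewrite mxE !derive_metric_cst //=; ring.
Qed.

Lemma christoffel_sym x u v : O x -> christoffel g x u v = christoffel g x v u.
Proof.
move=> Ox; apply: (inner_inj (gunit Ox)) => w; rewrite !christoffelE //.
by rewrite (derive_metric_sym w u) //; ring.
Qed.

Lemma christoffel_linr x u : O x -> linear (christoffel g x u).
Proof.
move=> Ox k v w; apply: (inner_inj (gunit Ox)) => z.
rewrite !(christoffelE, innerE) // (derive_metric_lin Ox) inner_mxD inner_mxZ.
by ring.
Qed.

Lemma christoffel_linl x v : O x -> linear (fun u => christoffel g x u v).
Proof.
by move=> Ox k u w; rewrite !(christoffel_sym _ v) //; exact: christoffel_linr.
Qed.

Lemma metric_compat x u v w : O x ->
  inner (Dg x u) v w = inner (g x) (christoffel g x u v) w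
                       + inner (g x) v (christoffel g x u w).
Proof.
move=> Ox; rewrite (inner_sym v _ (gsym Ox)) !christoffelE //.
rewrite (derive_metric_sym u w v) // (derive_metric_sym w u v) //.
by rewrite (derive_metric_sym v u w) //; field.
Qed.

Lemma differentiable_christoffel x u v : O x ->
  differentiable (fun z => christoffel g z u v) x.
Proof.
move=> Ox; apply: differentiable_mulmx; last first.
  by apply: differentiable_invmx; [exact: dg | exact: gunit].
apply/differentiable_mxP => i k.
have dc (c : 'rV[R]_d) := differentiable_cst c x.
pose h z := 2^-1 *: (inner (Dg z u) v (delta_mx 0 k)
   + inner (Dg z v) u (delta_mx 0 k) - inner (Dg z (delta_mx 0 k)) u v).
apply: (@near_eq_differentiable _ _ _ h).
  apply: filterS (open_near oO Ox) => z Oz.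
  by rewrite /h mxE !derive_metric_cst.
apply: differentiableZ; apply: differentiableB; last first.
  exact: (differentiable_inner (dDg _ Ox) (dc u) (dc v)).
apply: differentiableD.
  exact: (differentiable_inner (dDg _ Ox) (dc v) (dc _)).
exact: (differentiable_inner (dDg _ Ox) (dc u) (dc _)).
Qed.

End Christoffel.

(** * The Gauss equation *)

Local Opaque christoffel.

Lemma nabla_dual_cst (R : realType) (d : nat) (g : 'rV[R]_d -> 'M[R]_d)
    (P : 'rV[R]_d -> 'rV[R]_d) (p u v : 'rV[R]_d) :
  nabla_dual g P (cst u) (cst v) p =
  'D_u (fun x => inner (g x) (P x) v) p
  - inner (g p) (P p) (christoffel g p u v).
Proof. by rewrite /nabla_dual /levi_civita derive_cst add0r. Qed.

Lemma curvature_levi_civita_cst (R : realType) (d : nat)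
    (g : 'rV[R]_d -> 'M[R]_d) (p u v w : 'rV[R]_d) :
  linear (fun s => christoffel g p s w) ->
  curvature_at (levi_civita g) p u v w =
  'D_u (fun x => christoffel g x v w) p
  + christoffel g p u (christoffel g p v w)
  - ('D_v (fun x => christoffel g x u w) p
     + christoffel g p v (christoffel g p u w)).
Proof.
move=> Glin; rewrite /curvature_at /curvature.
have E s t : levi_civita g (cst s) (cst t) = fun x => christoffel g x s t.
  by apply/funext => x; rewrite /levi_civita derive_cst add0r.
have B : bracket (cst u) (cst v) = fun=> 0.
  by apply/funext => x; rewrite /bracket !derive_cst subrr.
have Z : levi_civita g (fun=> 0) (cst w) p = 0.
  by rewrite /levi_civita derive0 add0r (linear_at0 Glin).
by rewrite B Z subr0 !E.
Qed.

(** Here A - N is a tangential field, [DA], [DN] and [CA], [CN] are the derivatives and Christoffel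
    corrections of its two parts, and [K] is tangent. The hypothesis on [e] is the Weingarten
    identity; besides [e], only the pi-component of N survives. *)
Lemma inner_split_normal (R : realType) (d : nat) (G : 'M[R]_d)
    (Q DA DN A N CA CN V K : 'rV[R]_d) (a b c e : R) :
  inner G N K = 0 -> inner G DN K + inner G CN K = - e ->
  inner G (DA - DN + (CA - CN) + (a * c) *: (A - N)
           + (b * inner G Q (A - N)) *: V) K =
  inner G DA K + inner G CA K + a * c * inner G A K
  + b * inner G Q A * inner G V K + e - b * inner G Q N * inner G V K.
Proof. by move=> NK E; rewrite !innerE NK -[e]opprK -E; ring. Qed.

Section Gauss.
Variables (R : realType) (n d : nat).
Variables (O : set 'rV[R]_d) (g : 'rV[R]_d -> 'M[R]_d) (P : 'rV[R]_d -> 'rV[R]_d).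
Hypotheses (oO : open O) (sg : smooth_on O g) (sP : smooth_on O P).
Hypothesis gsym : forall x, O x -> (g x)^T = g x.
Hypothesis gpos : forall x u, O x -> u != 0 -> 0 < inner (g x) u u.
Variables (a b : R) (U : set 'rV[R]_n) (f : 'rV[R]_n -> 'rV[R]_d).
Hypotheses (oU : open U) (sf : smooth_on U f) (fO : forall z, U z -> O (f z)).
Hypothesis finj : forall z, U z -> injective ('d f z).
Implicit Types (u v w k z : 'rV[R]_n) (W : 'rV[R]_d).

Variable Dg : 'rV[R]_d -> 'rV[R]_d -> 'M[R]_d.
Hypothesis DgE : forall x u : 'rV[R]_d, 'D_u g x = Dg x u.
Variable Df : 'rV[R]_n -> 'rV[R]_n -> 'rV[R]_d.
Hypothesis DfE : forall u z, 'D_u f z = Df u z.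
Variable DDf : 'rV[R]_n -> 'rV[R]_n -> 'rV[R]_n -> 'rV[R]_d.
Hypothesis DDfE : forall u v z, 'D_u (Df v) z = DDf u v z.

Let C := christoffel g.
Let Csym := christoffel_sym oO sg DgE gsym gpos.
Let Clinl := christoffel_linl oO sg DgE gsym gpos.
Let Clinr := christoffel_linr sg DgE gpos.
Let dC := differentiable_christoffel oO sg DgE gpos.
Let compat := metric_compat oO sg DgE gsym gpos.

Let DfF u : Df u = 'D_u f.
Proof. by apply/funext => z; rewrite DfE. Qed.

Let DDfF u v : DDf u v = 'D_u ('D_v f).
Proof. by apply/funext => z; rewrite -DDfE DfF. Qed.

Let df z : U z -> differentiable f z.
Proof. exact: smooth_differentiable. Qed.

Let dDf u z : U z -> differentiable (Df u) z.
Proof. by rewrite DfF; apply/smooth_differentiable/smooth_derive. Qed.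

Let dDDf u v z : U z -> differentiable (DDf u v) z.
Proof.
by rewrite DDfF; apply/smooth_differentiable/smooth_derive/smooth_derive.
Qed.

Let dg z : U z -> differentiable g (f z).
Proof. by move=> /fO; exact: smooth_differentiable. Qed.

Let dP z : U z -> differentiable P (f z).
Proof. by move=> /fO; exact: smooth_differentiable. Qed.

Let dgf z : U z -> differentiable (fun z => g (f z)) z.
Proof. by move=> Uz; exact: (differentiable_comp (df Uz) (dg Uz)). Qed.

Let dPf z : U z -> differentiable (fun z => P (f z)) z.
Proof. by move=> Uz; exact: (differentiable_comp (df Uz) (dP Uz)). Qed.

Lemma diff_Df u z : U z -> 'd f z u = Df u z.
Proof. by move=> Uz; rewrite -DfE deriveE //; exact: df. Qed.

Let JE u z : U z -> u *m jacobian f z = Df u z.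
Proof. by move=> Uz; rewrite -deriveEjacobian ?DfE //; exact: df. Qed.

Let Df_lin z : U z -> linear (fun u => Df u z).
Proof. by move=> Uz k u v; rewrite -!diff_Df // linearP. Qed.

Let DDf_sym u v z : U z -> DDf u v z = DDf v u z.
Proof.
move=> Uz; rewrite -!DDfE !DfF; apply: derive_comm.
- by apply: filterS (open_near oU Uz) => t; exact: df.
- by rewrite -DfF; exact: dDf.
- by rewrite -DfF; exact: dDf.
Qed.

Lemma inner_pullback z u v : U z ->
  inner (pullback g f z) u v = inner (g (f z)) (Df u z) (Df v z).
Proof. by move=> Uz; rewrite /pullback inner_congr !JE. Qed.

Let pullback_unit z : U z -> pullback g f z \in unitmx.
Proof.
move=> Uz; apply: posdef_unitmx => u u0; rewrite inner_pullback //.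
apply: gpos; first exact: fO.
apply: contra u0 => /eqP Dfu; apply/eqP; apply: (finj Uz).
by rewrite linear0 diff_Df.
Qed.

Lemma inner_tangential z W u : U z ->
  inner (pullback g f z) (tangential g f z W) u = inner (g (f z)) W (Df u z).
Proof.
by move=> Uz; rewrite inner_proj ?pullback_unit // JE.
Qed.

Lemma tangentialK z u : U z -> tangential g f z (Df u z) = u.
Proof.
move=> Uz; apply: (inner_inj (pullback_unit Uz)) => w.
by rewrite inner_tangential // inner_pullback.
Qed.

Lemma tangential_lin z : linear (tangential g f z).
Proof. by move=> k V W; rewrite /tangential !mulmxDl -!scalemxAl. Qed.

Let pi_ z W := inner (g (f z)) (P (f z)) W.

(** Ambient connection of the images of constant fields, the chart coordinates of its tangential
    part ([Y]) and its normal part ([N]), kept as functions of the point because they are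
    differentiated below. *)
Let A u v z := DDf u v z + C (f z) (Df u z) (Df v z)
  + (a * pi_ z (Df u z)) *: Df v z + (b * pi_ z (Df v z)) *: Df u z.
Let Y u v z := tangential g f z (A u v z).
Let N u v z := A u v z - Df (Y u v z) z.

Let ambient_conn_cst u X z : U z ->
  ambient_conn g P a b f (cst u) X z =
  'D_u (fun t => 'd f t (X t)) z + C (f z) (Df u z) (Df (X z) z)
  + (a * pi_ z (Df u z)) *: Df (X z) z + (b * pi_ z (Df (X z) z)) *: Df u z.
Proof. by move=> Uz; rewrite -(diff_Df u Uz) -(diff_Df (X z) Uz). Qed.

Let ambient_connE u v z : U z ->
  ambient_conn g P a b f (cst u) (cst v) z = A u v z.
Proof.
move=> Uz; rewrite (ambient_conn_cst u (cst v) Uz).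
have E : \forall t \near z, 'd f t v = Df v t.
  by apply: filterS (open_near oU Uz) => t; exact: diff_Df.
by rewrite (near_eq_derive u E) DDfE.
Qed.

Lemma sffE u v z : U z -> sff g P a b f z u v = N u v z.
Proof.
by move=> Uz; rewrite /sff /second_fund /induced_conn ambient_connE // diff_Df.
Qed.

Let normal u v k z : U z -> inner (g (f z)) (N u v z) (Df k z) = 0.
Proof.
move=> Uz; rewrite innerDl innerNl -inner_pullback //.
by rewrite inner_tangential // subrr.
Qed.

(** [A u v] and [A v u] differ by the torsion (a-b)(pi(u) v - pi(v) u), which is tangent and has no
    normal part. *)
Let N_sym u v z : U z -> N u v z = N v u z.
Proof.
move=> Uz; pose c := (a - b) * pi_ z (Df u z); pose e := (a - b) * pi_ z (Df v z).
have AE : A u v z = A v u z + (c *: Df v z - e *: Df u z).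
  rewrite /A (DDf_sym u v Uz) /C (Csym (Df u z) _ (fO Uz)) /c /e.
  by apply/rowP => i; rewrite !mxE; ring.
rewrite /N /Y AE.
have -> : tangential g f z (A v u z + (c *: Df v z - e *: Df u z)) =
    tangential g f z (A v u z) + (c *: v - e *: u).
  have Tl := tangential_lin z; pose L : {linear 'rV[R]_d -> 'rV[R]_n} :=
    HB.pack (tangential g f z) (GRing.isLinear.Build _ _ _ _ _ Tl).
  rewrite -[tangential g f z]/(L : _ -> _) linearD linearB !linearZ /=.
  by rewrite !tangentialK.
rewrite -!JE // mulmxDl mulmxBl -!scalemxAl !JE // opprD addrACA subrr.
by rewrite addr0.
Qed.

Lemma sff_sym u v z : U z -> sff g P a b f z u v = sff g P a b f z v u.
Proof. by move=> Uz; rewrite !sffE // N_sym. Qed.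

Lemma sff_lin u z : U z -> linear (sff g P a b f z u).
Proof.
move=> Uz k v w; rewrite !sffE // /N /Y.
have DDl : linear (fun v => DDf u v z).
  move=> l s t; have E : \forall q \near z,
      l *: Df s q + Df t q = Df (l *: s + t) q.
    by apply: filterS (open_near oU Uz) => q Uq; rewrite Df_lin.
  have dc : differentiable (cst l) z by exact: differentiable_cst.
  rewrite -!DDfE -(near_eq_derive u E).
  rewrite (derive_addf u (differentiable_scalef dc (dDf s Uz)) (dDf t Uz)).
  by rewrite (derive_scalef u dc (dDf s Uz)) derive_cst scale0r add0r.
have AE : A u (k *: v + w) z = k *: A u v z + A u w z.
  rewrite /A DDl (Df_lin Uz) /C (Clinr _ (fO Uz)) /pi_ innerDr innerZr.
  by apply/rowP => i; rewrite !mxE; ring.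
rewrite AE (tangential_lin z) (Df_lin Uz).
by apply/rowP => i; rewrite !mxE; ring.
Qed.

Variable y : 'rV[R]_n.
Hypothesis Uy : U y.
Let p := f y.
Let Op : O p := fO Uy.

Variable dpi : 'rV[R]_d -> 'rV[R]_d -> R.
Hypothesis dpiE :
  forall V W, 'D_V (fun x => inner (g x) (P x) W) p = dpi V W.
Variable DC : 'rV[R]_d -> 'rV[R]_d -> 'rV[R]_d -> 'rV[R]_d.
Hypothesis DCE :
  forall V W Z, 'D_V (fun x => C x W Z) p = DC V W Z.
Variable D3 : 'rV[R]_n -> 'rV[R]_n -> 'rV[R]_n -> 'rV[R]_d.
Hypothesis D3E : forall u v w, 'D_u (DDf v w) y = D3 u v w.

Let dCf v w :
  differentiable (fun z => C (f z) (Df v z) (Df w z)) y.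
Proof.
exact: (differentiable_bilinear_field Clinl Clinr oO Op (df Uy)
  (dDf v Uy) (dDf w Uy) (fun s t => dC s t Op)).
Qed.

Let DCf u v w :
  'D_u (fun z => C (f z) (Df v z) (Df w z)) y =
  DC (Df u y) (Df v y) (Df w y) + C p (DDf u v y) (Df w y)
  + C p (Df v y) (DDf u w y).
Proof.
rewrite (derive_bilinear_field Clinl Clinr oO Op (df Uy)
  (dDf v Uy) (dDf w Uy) (fun s t => dC s t Op)).
by rewrite DfE !DDfE DCE.
Qed.

Let dpif v : differentiable (fun z => pi_ z (Df v z)) y.
Proof. exact: (differentiable_inner (dgf Uy) (dPf Uy) (dDf v Uy)). Qed.

Let Dpif u v : 'D_u (fun z => pi_ z (Df v z)) y =
  dpi (Df u y) (Df v y) + pi_ y (DDf u v y).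
Proof.
have Dp V W : dpi V W = inner ('D_V g p) (P p) W + inner (g p) ('D_V P p) W.
  have dc : differentiable (cst W) p by exact: differentiable_cst.
  by rewrite -dpiE (derive_inner (dg Uy) (dP Uy) dc) derive_cst inner0r addr0.
rewrite (derive_inner (dgf Uy) (dPf Uy) (dDf v Uy)) DDfE Dp.
by rewrite (deriveE_comp u (df Uy) (dg Uy)) (deriveE_comp u (df Uy) (dP Uy)) DfE.
Qed.

Let cpif (c : R) u v : 'D_u (fun z => c * pi_ z (Df v z)) y =
  c * (dpi (Df u y) (Df v y) + pi_ y (DDf u v y)).
Proof. by rewrite (derive_mulcf c u (dpif v)) Dpif. Qed.

Let dcpif (c : R) v : differentiable (fun z => c * pi_ z (Df v z)) y.
Proof. exact: (differentiableM (differentiable_cst c y) (dpif v)). Qed.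

Let dA1 v w :
  differentiable (fun z => DDf v w z + C (f z) (Df v z) (Df w z)) y.
Proof. exact: (differentiableD (dDDf v w Uy) (dCf v w)). Qed.

Let dA2 v w :
  differentiable (fun z => (a * pi_ z (Df v z)) *: Df w z) y.
Proof. exact: (differentiable_scalef (dcpif a v) (dDf w Uy)). Qed.

Let dA3 v w :
  differentiable (fun z => (b * pi_ z (Df w z)) *: Df v z) y.
Proof. exact: (differentiable_scalef (dcpif b w) (dDf v Uy)). Qed.

Let dA v w : differentiable (A v w) y.
Proof. exact: (differentiableD (differentiableD (dA1 v w) (dA2 v w)) (dA3 v w)). Qed.

Let DA u v w : 'D_u (A v w) y =
  D3 u v w + (DC (Df u y) (Df v y) (Df w y) + C p (DDf u v y) (Df w y)
              + C p (Df v y) (DDf u w y))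
  + ((a * (dpi (Df u y) (Df v y) + pi_ y (DDf u v y))) *: Df w y
     + (a * pi_ y (Df v y)) *: DDf u w y)
  + ((b * (dpi (Df u y) (Df w y) + pi_ y (DDf u w y))) *: Df v y
     + (b * pi_ y (Df w y)) *: DDf u v y).
Proof.
rewrite (derive_addf u (differentiableD (dA1 v w) (dA2 v w)) (dA3 v w)).
rewrite (derive_addf u (dA1 v w) (dA2 v w)).
rewrite (derive_addf u (dDDf v w Uy) (dCf v w)) DCf D3E.
rewrite (derive_scalef u (dcpif a v) (dDf w Uy)) cpif DDfE.
by rewrite (derive_scalef u (dcpif b w) (dDf v Uy)) cpif DDfE.
Qed.

Let dJ : differentiable (jacobian f) y.
Proof.
pose J z : 'M[R]_(n, d) := \matrix_(i, j) Df (delta_mx 0 i) z 0 j.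
apply: (@near_eq_differentiable _ _ _ J).
  apply: filterS (open_near oU Uy) => z Uz.
  by apply/row_matrixP => i; rewrite [RHS]rowE JE //; apply/rowP => j; rewrite !mxE.
apply/differentiable_mxP => i j.
have -> : (fun z => J z i j) = (fun z => Df (delta_mx 0 i) z 0 j).
  by apply/funext => z; rewrite mxE.
exact: (differentiable_entry 0 j (dDf _ Uy)).
Qed.

(** The inverse of the induced metric enters through [Y]; no formula for the derivative is required,
    since [weingarten] determines its products with tangent vectors. *)
Let dN v w : differentiable (N v w) y.
Proof.
have dJT := differentiable_tr dJ.
have dpb : differentiable (pullback g f) y.
  exact: (differentiable_mulmx (differentiable_mulmx dJ (dgf Uy)) dJT).
have dY : differentiable (Y v w) y.
  exact: (differentiable_mulmx (differentiable_mulmx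
    (differentiable_mulmx (dA v w) (dgf Uy)) dJT)
    (differentiable_invmx dpb (pullback_unit Uy))).
apply: (@near_eq_differentiable _ _ _ (fun z => A v w z - Y v w z *m jacobian f z)).
  by apply: filterS (open_near oU Uy) => z Uz; rewrite JE.
exact: (differentiableB (dA v w) (differentiable_mulmx dY dJ)).
Qed.

Variable DN : 'rV[R]_n -> 'rV[R]_n -> 'rV[R]_n -> 'rV[R]_d.
Hypothesis DNE : forall u v w, 'D_u (N v w) y = DN u v w.

(** Differentiate g(N, df k) = 0 and turn the derivative of the metric into Christoffel terms. The
    a- and b-terms of [A u k] and its tangential part are orthogonal to [N v w], which leaves
    [N u k]. *)
Let weingarten u v w k :
  inner (g p) (DN u v w) (Df k y) + inner (g p) (C p (Df u y) (N v w y)) (Df k y)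
  = - inner (g p) (N v w y) (N u k y).
Proof.
have E : \forall z \near y, inner (g (f z)) (N v w z) (Df k z) = 0.
  by apply: filterS (open_near oU Uy) => z; exact: normal.
have NA : inner (g p) (N v w y) (N u k y) =
    inner (g p) (N v w y) (DDf u k y)
    + inner (g p) (N v w y) (C p (Df u y) (Df k y)).
  have -> : N u k y = A u k y - Df (Y u k y) y by [].
  by rewrite /A !innerDr innerNr !innerZr !normal // !mulr0 subr0 !addr0.
have := near_eq_derive u E.
rewrite derive_cst (derive_inner (dgf Uy) (dN v w) (dDf k Uy)).
rewrite DNE DDfE (deriveE_comp u (df Uy) (dg Uy)) DfE DgE (compat _ _ _ Op) NA.
rewrite -/p -/C.
move: (inner _ _ _) (inner _ _ _) (inner _ _ _) (inner _ _ _) => ? ? ? ?; lra.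
Qed.

Let X v w z := induced_conn g P a b f (cst v) (cst w) z.

Let XE v w z : U z -> X v w z = Y v w z.
Proof. by move=> Uz; rewrite /X /induced_conn ambient_connE. Qed.

(** The image of the field [X v w] is A - N, so its derivative is the explicit one of [A] minus that
    of [N]. *)
Let ambient_conn_X u v w :
  ambient_conn g P a b f (cst u) (X v w) y =
  'D_u (A v w) y - DN u v w + C p (Df u y) (A v w y - N v w y)
  + (a * pi_ y (Df u y)) *: (A v w y - N v w y)
  + (b * pi_ y (A v w y - N v w y)) *: Df u y.
Proof.
have NE z : A v w z - N v w z = Df (Y v w z) z by rewrite /N subKr.
rewrite (ambient_conn_cst u (X v w) Uy) XE // -NE.
have E : \forall z \near y, 'd f z (X v w z) = A v w z - N v w z.
  by apply: filterS (open_near oU Uy) => z Uz; rewrite XE // NE diff_Df.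
by rewrite (near_eq_derive u E) (derive_subf u (dA v w) (dN v w)) DNE.
Qed.

Let induced_conn0 w : induced_conn g P a b f (fun=> 0) (cst w) y = 0.
Proof.
rewrite /induced_conn -/(cst 0) ambient_connE // /A -DDfE derive0.
rewrite (linear_at0 (Df_lin Uy)) /C (linear_at0 (Clinl _ Op)) /pi_ inner0r.
by rewrite mulr0 scale0r scaler0 !addr0 (linear_at0 (tangential_lin _)).
Qed.

(** [al] is the covariant derivative of pi for the ambient Levi-Civita connection; [al] plus pi of
    the second fundamental form is that of the restriction of pi for the induced one. The a- and
    b-terms are those of the curvature of nabla + a pi(X) Y + b pi(Y) X on the submanifold. *)
Lemma gauss_equation u v w k :
  let V := Df v y in let W := Df w y in let K := Df k y in
  let al S T := dpi S T - pi_ y (C p S T) in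
  let G := inner (g p) in
  let II := sff g P a b f y in
  induced_riem g P a b f y u v w k =
  G (DC (Df u y) V W + C p (Df u y) (C p V W)
     - (DC V (Df u y) W + C p V (C p (Df u y) W))) K
  + a * (al (Df u y) V - al V (Df u y)) * G W K
  + b * (al (Df u y) W + pi_ y (II u w)) * G V K
  - b * (al V W + pi_ y (II v w)) * G (Df u y) K
  + b ^+ 2 * pi_ y W * (pi_ y V * G (Df u y) K - pi_ y (Df u y) * G V K)
  + G (II v w) (II u k) - G (II u w) (II v k).
Proof.
move=> V W K al G II; rewrite /II !sffE //.
have D3C : D3 u v w = D3 v u w.
  rewrite -!D3E !DDfF; apply: derive_comm.
  - by apply: filterS (open_near oU Uy) => z Uz; rewrite -DfF; exact: dDf.
  - by rewrite -DDfF; exact: dDDf.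
  - by rewrite -DDfF; exact: dDDf.
(* Used for both second covariant derivatives, once in the order (u, v) and once in the order (v,
   u). *)
have Q s t l r :
    inner (pullback g f y) (induced_conn g P a b f (cst s) (X t l) y) r =
    G ('D_s (A t l) y) (Df r y) + G (C p (Df s y) (A t l y)) (Df r y)
    + a * pi_ y (Df s y) * G (A t l y) (Df r y)
    + b * pi_ y (A t l y) * G (Df s y) (Df r y)
    + G (N t l y) (N s r y) - b * pi_ y (N t l y) * G (Df s y) (Df r y).
  rewrite /induced_conn inner_tangential // ambient_conn_X.
  have Cl := Clinr (Df s y) Op; pose L : {linear 'rV[R]_d -> 'rV[R]_d} :=
    HB.pack (C p (Df s y)) (GRing.isLinear.Build _ _ _ _ _ Cl).
  have -> : C p (Df s y) (A t l y - N t l y) =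
      C p (Df s y) (A t l y) - C p (Df s y) (N t l y).
    by rewrite -[C p (Df s y)]/(L : _ -> _) linearB.
  exact: (inner_split_normal _ _ _ _ _ _ _ _ (normal t l r Uy)
    (weingarten s t l r)).
have CA s t l : C p (Df s y) (A t l y) =
    C p (Df s y) (DDf t l y) + C p (Df s y) (C p (Df t y) (Df l y))
    + (a * pi_ y (Df t y)) *: C p (Df s y) (Df l y)
    + (b * pi_ y (Df l y)) *: C p (Df s y) (Df t y).
  have Cl := Clinr (Df s y) Op; pose L : {linear 'rV[R]_d -> 'rV[R]_d} :=
    HB.pack (C p (Df s y)) (GRing.isLinear.Build _ _ _ _ _ Cl).
  by rewrite -[C p (Df s y)]/(L : _ -> _) /A !linearD !linearZ.
rewrite /induced_riem /curvature_at /curvature.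
have -> : bracket (cst u) (cst v) = fun=> 0.
  by apply/funext => z; rewrite /bracket !derive_cst subrr.
rewrite induced_conn0 subr0 -!/(X _ _) innerDl innerNl !Q.
rewrite !DA !CA -D3C (DDf_sym v u Uy).
rewrite /al /V /W /K /G.
rewrite (_ : C p (Df v y) (Df u y) = C p (Df u y) (Df v y)); last first.
  by rewrite /C (Csym _ _ Op).
move: (N v w y) (N u k y) (N u w y) (N v k y) => n1 n2 n3 n4.
rewrite /A /pi_ -/p.
move: (DC _ _ _) (DC _ _ _) (C p (Df u y) (C p (Df v y) (Df w y)))
  (C p (Df v y) (C p (Df u y) (Df w y))) => d1 d2 c1 c2.
move: (C p (DDf u v y) (Df w y)) (C p (Df v y) (DDf u w y))
  (C p (Df u y) (DDf v w y)) (C p (Df u y) (Df v y)) (C p (Df u y) (Df w y))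
  (C p (Df v y) (Df w y)) => c3 c4 c5 c6 c7 c8.
move: (D3 u v w) (DDf u v y) (DDf u w y) (DDf v w y) => d3 e1 e2 e3.
move: (dpi (Df u y) (Df v y)) (dpi (Df u y) (Df w y)) (dpi (Df v y) (Df u y))
  (dpi (Df v y) (Df w y)) => s1 s2 s3 s4.
move: (Df u y) (Df v y) (Df w y) (Df k y) (g p) (P p) => V1 V2 V3 V4 Gp Pp.
by rewrite !innerE; ring.
Qed.

End Gauss.

(** * Chen's inequality *)

Section PairSums.
Variables (R : realType) (n : nat).
Implicit Types (x : 'I_n -> R) (f : 'I_n -> 'I_n -> R).

Lemma sum_lt_sym f : (forall i j, f i j = f j i) -> (forall i, f i i = 0) ->
  \sum_(i < n) \sum_(j < n | (i < j)%N) f i j = 2^-1 * \sum_i \sum_j f i j.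
Proof.
move=> fS f0; have -> : \sum_i \sum_j f i j =
    \sum_(i < n) \sum_(j < n | (i < j)%N) f i j
    + \sum_(i < n) \sum_(j < n | (j < i)%N) f i j.
  rewrite -big_split; apply: eq_bigr => i _ /=.
  rewrite (bigID (fun j : 'I_n => (i < j)%N)) /=; congr (_ + _).
  rewrite (bigD1 i) ?ltnn //= f0 add0r; apply: eq_bigl => j.
  by rewrite -leqNgt [RHS]ltn_neqAle -val_eqE andbC.
have -> : \sum_(i < n) \sum_(j < n | (j < i)%N) f i j =
    \sum_(i < n) \sum_(j < n | (i < j)%N) f i j.
  rewrite (exchange_big_dep predT) //=; apply: eq_bigr => i _.
  by apply: eq_bigr => j _; exact: fS.
by field.
Qed.

(** Every index lies in n-1 pairs. *)
Lemma sum_lt_add x :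
  \sum_(i < n) \sum_(j < n | (i < j)%N) (x i + x j) = (n%:R - 1) * \sum_i x i.
Proof.
(* The factor clears the diagonal, as [sum_lt_sym] requires. *)
pose f (i j : 'I_n) := (i != j)%:R * (x i + x j).
transitivity (\sum_(i < n) \sum_(j < n | (i < j)%N) f i j).
  apply: eq_bigr => i _; apply: eq_bigr => j ij.
  by rewrite /f neq_ltn ij mul1r.
rewrite sum_lt_sym; first last.
- by move=> i; rewrite /f eqxx mul0r.
- by move=> i j; rewrite /f eq_sym addrC.
have -> : \sum_i \sum_j f i j =
    \sum_i \sum_j (x i + x j) - \sum_i (x i + x i).
  rewrite -sumrB; apply: eq_bigr => i _.
  rewrite (bigD1 i) //= [X in _ = X - _](bigD1 i) //= /f eqxx mul0r add0r.
  rewrite addrAC subrr add0r; apply: eq_bigr => j ji.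
  by rewrite eq_sym ji mul1r.
have -> : \sum_i \sum_j (x i + x j) = (n%:R + n%:R) * \sum_i x i.
  under eq_bigr do rewrite big_split sumr_const card_ord /=.
  by rewrite big_split sumr_const card_ord /= sumrMnl -mulr_natl; ring.
by rewrite big_split /=; field.
Qed.

Lemma sum_lt_cst (c : R) :
  \sum_(i < n) \sum_(j < n | (i < j)%N) c = n%:R * (n%:R - 1) / 2 * c.
Proof.
have -> : \sum_(i < n) \sum_(j < n | (i < j)%N) c =
    \sum_(i < n) \sum_(j < n | (i < j)%N) (c / 2 + c / 2).
  by apply: eq_bigr => i _; apply: eq_bigr => j _; rewrite -splitr.
rewrite (sum_lt_add (fun=> c / 2)) sumr_const card_ord -mulr_natl.
by field.
Qed.

End PairSums.

Section Chen.
Variables (R : realType) (n d : nat) (G : 'M[R]_d).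
Hypothesis Gsym : forall u v, inner G u v = inner G v u.
Hypothesis Gge0 : forall u, 0 <= inner G u u.
Implicit Types (M : 'I_n -> 'I_n -> 'rV[R]_d) (x y : 'I_n -> R).

Definition frob M M' : R := \sum_i \sum_j inner G (M i j) (M' i j).
Definition quad M x y : 'rV[R]_d := \sum_i \sum_j (x i * y j) *: M i j.

Lemma frob_sub_ge0 M M' : 0 <= frob M M - 2 * frob M M' + frob M' M'.
Proof.
have <- : frob (fun i j => M i j - M' i j) (fun i j => M i j - M' i j) =
    frob M M - 2 * frob M M' + frob M' M'.
  rewrite mulr_sumr -sumrB -big_split; apply: eq_bigr => i _ /=.
  rewrite mulr_sumr -sumrB -big_split; apply: eq_bigr => j _ /=.
  by rewrite !innerE (Gsym (M' i j)); ring.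
by apply: sumr_ge0 => i _; apply: sumr_ge0.
Qed.

Lemma inner_quad M x y v :
  inner G (quad M x y) v = \sum_i \sum_j x i * y j * inner G (M i j) v.
Proof.
rewrite inner_suml; apply: eq_bigr => i _; rewrite inner_suml.
by apply: eq_bigr => j _; rewrite innerZl.
Qed.

Variables (x y : 'I_n -> R) (l n00 n11 n01 : 'rV[R]_d).
Hypotheses (xx : \sum_i x i * x i = 1) (yy : \sum_i y i * y i = 1).
Hypothesis xy : \sum_i x i * y i = 0.

(** The multiple [l] of the metric is meant for the complement of the plane. The identity also puts
    it on the plane, where subtracting [l] from [n00] and [n11] removes it; the mixed entry needs no
    correction because [x] and [y] are orthogonal. *)
Definition block_diag i j : 'rV[R]_d :=
  (i == j)%:R *: l + (x i * x j) *: (n00 - l) + (y i * y j) *: (n11 - l)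
  + (x i * y j + y i * x j) *: n01.

Lemma frob_block_diag M :
  frob M block_diag =
  inner G (\sum_i M i i) l + inner G (quad M x x) (n00 - l)
  + inner G (quad M y y) (n11 - l)
  + (inner G (quad M x y) n01 + inner G (quad M y x) n01).
Proof.
rewrite !inner_quad.
have -> : inner G (\sum_i M i i) l =
    \sum_i \sum_j (i == j)%:R * inner G (M i j) l.
  rewrite inner_suml; apply: eq_bigr => i _.
  rewrite (bigD1 i) //= eqxx mul1r big1 ?addr0 // => j ji.
  by rewrite eq_sym (negbTE ji) mul0r.
rewrite -!big_split; apply: eq_bigr => i _; rewrite -!big_split.
by apply: eq_bigr => j _; rewrite /block_diag !(innerDr, innerZr) /=; ring.
Qed.

Lemma quad_block_diag p q :
  quad block_diag p q =
  (\sum_i p i * q i) *: l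
  + ((\sum_i p i * x i) * (\sum_i q i * x i)) *: (n00 - l)
  + ((\sum_i p i * y i) * (\sum_i q i * y i)) *: (n11 - l)
  + ((\sum_i p i * x i) * (\sum_i q i * y i)
     + (\sum_i p i * y i) * (\sum_i q i * x i)) *: n01.
Proof.
have prod (r s : 'I_n -> R) : (\sum_i p i * r i) * (\sum_i q i * s i) =
    \sum_i \sum_j (p i * q j) * (r i * s j).
  rewrite mulr_suml; apply: eq_bigr => i _; rewrite mulr_sumr.
  by apply: eq_bigr => j _; ring.
have -> : \sum_i p i * q i = \sum_i \sum_j (p i * q j) * (i == j)%:R.
  apply: eq_bigr => i _; rewrite (bigD1 i) //= eqxx mulr1 big1 ?addr0 //.
  by move=> j ji; rewrite eq_sym (negbTE ji) mulr0.
rewrite !prod scalerDl !scaler_suml -!big_split; apply: eq_bigr => i _.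
rewrite !scaler_suml -!big_split; apply: eq_bigr => j _ /=.
by rewrite /block_diag; apply/rowP => k; rewrite !mxE; ring.
Qed.

Lemma trace_block_diag :
  \sum_i block_diag i i = n%:R *: l + (n00 - l) + (n11 - l).
Proof.
rewrite !big_split /= -!scaler_suml big_split /= xx yy xy.
have -> : \sum_i y i * x i = 0.
  by rewrite -[RHS]xy; apply: eq_bigr => i _; rewrite mulrC.
have -> : \sum_(i < n) (i == i)%:R = n%:R :> R.
  by under eq_bigr do rewrite eqxx; rewrite sumr_const card_ord.
by rewrite !scale1r addr0 scale0r addr0.
Qed.

End Chen.

(** Two squares are used. |M - C|^2 >= 0 gives |M|^2 >= |T|^2/m + |N0|^2 + |N1|^2 + 2|N2|^2, and |T
    - m(N0+N1)|^2 >= 0 bounds |H|^2/(m+1) by |T|^2/m + |N0+N1|^2. The subtracted bracket supplies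
    the product of N0 and N1 and absorbs |N2|^2. *)
Lemma chen_inequality (R : realType) (n d : nat) (G : 'M[R]_d)
    (M : 'I_n -> 'I_n -> 'rV[R]_d) (x y : 'I_n -> R) (H : 'rV[R]_d) :
  (forall u v, inner G u v = inner G v u) -> (forall u, 0 <= inner G u u) ->
  (3 <= n)%N -> (forall i j, M i j = M j i) ->
  \sum_i x i * x i = 1 -> \sum_i y i * y i = 1 -> \sum_i x i * y i = 0 ->
  H = \sum_i M i i ->
  2^-1 * (inner G H H - frob G M M)
  - (inner G (quad M x x) (quad M y y) - inner G (quad M x y) (quad M x y))
  <= (n%:R - 2) / (2 * (n%:R - 1)) * inner G H H.
Proof.
move=> Gsym Gge0 n3 Msym xx yy xy Htr.
pose N0 := quad M x x; pose N1 := quad M y y; pose N2 := quad M x y.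
have N2C : quad M y x = N2.
  rewrite /N2 /quad exchange_big; apply: eq_bigr => i _; apply: eq_bigr => j _.
  by rewrite mulrC Msym.
(* Dimension of the complement of the plane, positive because n >= 3. *)
pose m : R := n%:R - 2.
have m0 : 0 < m by rewrite subr_gt0 (ltr_nat R 2 n).
(* [T] is the trace of the form on the complement of the plane, and [l] below is its mean value
   there. *)
have [T HE] : exists T, H = T + (N0 + N1).
  by exists (H - (N0 + N1)); rewrite subrK.
pose l := m^-1 *: T.
pose C := block_diag x y l N0 N1 N2.
have yx : \sum_i y i * x i = 0.
  by rewrite -[RHS]xy; apply: eq_bigr => i _; rewrite mulrC.
have Cxx : quad C x x = N0.
  by rewrite /C quad_block_diag xx xy; apply/rowP => k; rewrite !mxE; ring.
have Cyy : quad C y y = N1.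
  by rewrite /C quad_block_diag yy yx; apply/rowP => k; rewrite !mxE; ring.
have Cxy : quad C x y = N2.
  by rewrite /C quad_block_diag xx yy xy yx; apply/rowP => k; rewrite !mxE; ring.
have Cyx : quad C y x = N2.
  by rewrite /C quad_block_diag xx yy xy yx; apply/rowP => k; rewrite !mxE; ring.
have nE : n%:R = m + 2 by rewrite /m subrK.
have E1 : frob G M C = m^-1 * inner G T T + inner G N0 N0 + inner G N1 N1
    + 2 * inner G N2 N2.
  rewrite (frob_block_diag G x y l N0 N1 N2 M) -Htr N2C -/N0 -/N1 -/N2 HE.
  by rewrite /l !innerE (Gsym N0) (Gsym N1) ?innerE; ring.
(* [C] is the orthogonal projection of [M] onto the forms of its shape, so |M - C|^2 = |M|^2 -
   |C|^2. *)
have E2 : frob G C C = frob G M C.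
  rewrite E1 {2}/C frob_block_diag Cxx Cyy Cxy Cyx /C trace_block_diag // nE.
  rewrite /l !innerE (Gsym _ T) ?innerE; field.
  by rewrite gt_eqF.
have F := frob_sub_ge0 Gsym Gge0 M C.
have S := Gge0 (T - m *: (N0 + N1)).
move: F S; rewrite E2 E1 HE -/N0 -/N1 -/N2 nE !innerE.
rewrite (Gsym N0 T) (Gsym N1 T) (Gsym N1 N0).
move: (inner G T T) (inner G T N0) (inner G T N1) (inner G N0 N0)
  (inner G N0 N1) (inner G N1 N1) (inner G N2 N2) (frob G M M)
  => t g0 g1 a0 c a1 e F0 F S.
(* With q = |T|^2/m as the unknown, the two squares become polynomial inequalities in m. *)
have tE : t = m * (m^-1 * t) by rewrite mulrA mulfV ?mul1r ?gt_eqF.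
have m1 : 0 < m + 1 by rewrite addr_gt0.
move: F S; rewrite tE mulKf ?gt_eqF //; move: (m^-1 * t) => {tE} q F S.
have {}S : 0 <= q - 2 * (g0 + g1) + m * (a0 + 2 * c + a1).
  by rewrite -(pmulr_rge0 _ m0); apply: le_trans S _; rewrite le_eqVlt; apply/orP;
    left; apply/eqP; ring.
(* [hh] is |H|^2 for H = T + N0 + N1, and m + 1 = n - 1 is the denominator in the final constant. *)
pose hh := m * q + 2 * (g0 + g1) + (a0 + 2 * c + a1).
have hh_le : hh / (m + 1) <= q + (a0 + 2 * c + a1).
  by rewrite ler_pdivrMr // /hh; move: S; nra.
have -> : (m + 2 - 2) / (2 * (m + 2 - 1)) *
  (m * q + (g0 + g1) + (g0 + (a0 + c) + (g1 + (c + a1)))) =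
  2^-1 * (hh - hh / (m + 1)).
  by rewrite /hh; field; rewrite gt_eqF //; lra.
by rewrite mulrBr; move: hh_le; rewrite {2}/hh; lra.
Qed.

(** * Curvature of a contact space form *)

Section SpaceFormSectional.
Variables (R : realType) (d : nat) (G : 'M[R]_d) (kappa mu c : R).
Variables (phi h : 'rV[R]_d -> 'rV[R]_d) (xi : 'rV[R]_d) (eta : 'rV[R]_d -> R).
Hypothesis Gsym : forall u v, inner G u v = inner G v u.
Hypothesis skew : forall u v, inner G u (phi v) = - inner G (phi u) v.
Hypothesis dual : forall u, inner G u xi = eta u.
Hypothesis hsym : forall u v, inner G u (h v) = inner G (h u) v.
Hypothesis phsym : forall u v, inner G u (phi (h v)) = inner G (phi (h u)) v.

Definition space_form_sectional (X Y : 'rV[R]_d) : R :=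
  (c + 3) / 4 - (c + 3 - 4 * kappa) / 4 * (eta X ^+ 2 + eta Y ^+ 2)
  + (c - 1) / 4 * 3 * inner G (phi X) Y ^+ 2
  + 2^-1 * (inner G X (h X) * inner G Y (h Y) - inner G X (h Y) ^+ 2
            - (inner G X (phi (h X)) * inner G Y (phi (h Y))
               - inner G X (phi (h Y)) ^+ 2))
  + inner G X (h X) + inner G Y (h Y)
  - (1 - mu) * (eta X ^+ 2 * inner G Y (h Y) + eta Y ^+ 2 * inner G X (h X)
                - 2 * eta X * eta Y * inner G X (h Y)).

Variables X Y : 'rV[R]_d.
Hypotheses (XX : inner G X X = 1) (YY : inner G Y Y = 1) (XY : inner G X Y = 0).

Let skew0 u : inner G (phi u) u = 0.
Proof. by have := skew u u; rewrite Gsym; lra. Qed.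

(** Both orders occur in the symmetrized sectional curvature. Symmetry of h' and phi h' turns the
    mixed products into squares. *)
Lemma space_form_sectionalE :
  inner G (space_form_curvature kappa mu c G phi h xi eta X Y Y) X =
    space_form_sectional X Y /\
  inner G (space_form_curvature kappa mu c G phi h xi eta X Y X) Y =
    - space_form_sectional X Y.
Proof.
have YX : inner G Y X = 0 by rewrite Gsym.
have xiX u : inner G xi u = eta u by rewrite Gsym dual.
have f1 : inner G X (phi Y) = - inner G (phi X) Y by rewrite skew.
have f2 : inner G (phi Y) X = - inner G (phi X) Y by rewrite Gsym.
have f3 : inner G Y (phi X) = inner G (phi X) Y by rewrite Gsym.
have h1 : inner G (h X) X = inner G X (h X) by rewrite Gsym.
have h2 : inner G (h Y) Y = inner G Y (h Y) by rewrite Gsym.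
have h3 : inner G (h X) Y = inner G X (h Y) by rewrite hsym.
have h4 : inner G (h Y) X = inner G X (h Y) by rewrite Gsym.
have k1 : inner G (phi (h X)) X = inner G X (phi (h X)) by rewrite Gsym.
have k2 : inner G (phi (h Y)) Y = inner G Y (phi (h Y)) by rewrite Gsym.
have k3 : inner G (phi (h X)) Y = inner G X (phi (h Y)) by rewrite phsym.
have k4 : inner G (phi (h Y)) X = inner G X (phi (h Y)) by rewrite Gsym.
have p1 : inner G Y (phi Y) = 0 by rewrite Gsym skew0.
have p2 : inner G X (phi X) = 0 by rewrite Gsym skew0.
rewrite /space_form_curvature /space_form_sectional !innerE.
rewrite XX YY XY YX !xiX p1 p2 f1 f2 f3 !skew0 h1 h2 h3 h4 k1 k2 k3 k4.
by split; ring.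
Qed.

End SpaceFormSectional.

Section SpaceFormScalar.
Variables (R : realType) (n d : nat) (G : 'M[R]_d) (kappa mu c : R).
Variables (phi h : 'rV[R]_d -> 'rV[R]_d) (eta : 'rV[R]_d -> R).
Variable E : 'I_n -> 'rV[R]_d.
Hypothesis Gsym : forall u v, inner G u v = inner G v u.
Hypothesis skew : forall u v, inner G u (phi v) = - inner G (phi u) v.
Hypothesis hsym : forall u v, inner G u (h v) = inner G (h u) v.
Hypothesis phsym : forall u v, inner G u (phi (h v)) = inner G (phi (h u)) v.

(** Constants and terms in a single index are counted over pairs. The rest is symmetric and zero on
    the diagonal, hence half of a full double sum, which splits into traces and squared norms. *)
Lemma sum_space_form_sectional :
  \sum_(i < n) \sum_(j < n | (i < j)%N)
    space_form_sectional G kappa mu c phi h eta (E i) (E j) =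
  n%:R * (n%:R - 1) / 2 * ((c + 3) / 4)
  + (n%:R - 1) * (\sum_i inner G (E i) (h (E i))
                  - (c + 3 - 4 * kappa) / 4 * \sum_i eta (E i) ^+ 2)
  + (c - 1) / 8 * 3 * \sum_i \sum_j inner G (E i) (phi (E j)) ^+ 2
  + 4^-1 * ((\sum_i inner G (E i) (h (E i))) ^+ 2
            - \sum_i \sum_j inner G (E i) (h (E j)) ^+ 2
            - (\sum_i inner G (E i) (phi (h (E i)))) ^+ 2
            + \sum_i \sum_j inner G (E i) (phi (h (E j))) ^+ 2)
  - (1 - mu) * ((\sum_i eta (E i) ^+ 2) * (\sum_i inner G (E i) (h (E i)))
      - \sum_i \sum_j eta (E i) * eta (E j) * inner G (E i) (h (E j))).
Proof.
pose x i := inner G (E i) (h (E i)) - (c + 3 - 4 * kappa) / 4 * eta (E i) ^+ 2.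
pose f1 i j := inner G (E i) (phi (E j)) ^+ 2.
pose f2 i j := inner G (E i) (h (E i)) * inner G (E j) (h (E j)).
pose f3 i j := inner G (E i) (h (E j)) ^+ 2.
pose f4 i j := inner G (E i) (phi (h (E i))) * inner G (E j) (phi (h (E j))).
pose f5 i j := inner G (E i) (phi (h (E j))) ^+ 2.
pose f6 i j := eta (E i) ^+ 2 * inner G (E j) (h (E j)).
pose f7 i j := eta (E i) * eta (E j) * inner G (E i) (h (E j)).
(* On the diagonal [f1] is zero by skewness, [f2] cancels [f3], [f4] cancels [f5], and twice [f6]
   cancels twice [f7]. *)
pose r i j := (c - 1) / 4 * 3 * f1 i j
  + 2^-1 * (f2 i j - f3 i j - (f4 i j - f5 i j))
  - (1 - mu) * (f6 i j + f6 j i - 2 * f7 i j).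
have hC u v : inner G u (h v) = inner G v (h u) by rewrite hsym.
have kC u v : inner G u (phi (h v)) = inner G v (phi (h u)) by rewrite phsym.
have skew0 u : inner G u (phi u) = 0.
  by have := skew u u; rewrite [X in - X]Gsym; lra.
transitivity (\sum_(i < n) \sum_(j < n | (i < j)%N) ((c + 3) / 4)
  + \sum_(i < n) \sum_(j < n | (i < j)%N) (x i + x j)
  + \sum_(i < n) \sum_(j < n | (i < j)%N) r i j).
  rewrite -!big_split; apply: eq_bigr => i _; rewrite -!big_split.
  apply: eq_bigr => j _ /=.
  rewrite /space_form_sectional /r /f1 /f2 /f3 /f4 /f5 /f6 /f7 /x.
  rewrite (skew (E i) (E j)) sqrrN.
  by ring.
rewrite sum_lt_cst sum_lt_add sum_lt_sym; first last.
- by move=> i; rewrite /r /f1 /f2 /f3 /f4 /f5 /f6 /f7 skew0; ring.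
- move=> i j; rewrite /r /f1 /f2 /f3 /f4 /f5 /f6 /f7 (hC (E j) (E i)).
  by rewrite (kC (E j) (E i)) (skew (E j) (E i)) sqrrN (Gsym (phi _)); ring.
have -> : \sum_i x i = \sum_i inner G (E i) (h (E i))
    - (c + 3 - 4 * kappa) / 4 * \sum_i eta (E i) ^+ 2.
  by rewrite mulr_sumr -sumrB.
have -> : \sum_i \sum_j r i j = (c - 1) / 4 * 3 * (\sum_i \sum_j f1 i j)
    + 2^-1 * (\sum_i \sum_j f2 i j - \sum_i \sum_j f3 i j
              - (\sum_i \sum_j f4 i j - \sum_i \sum_j f5 i j))
    - (1 - mu) * (\sum_i \sum_j f6 i j + \sum_i \sum_j f6 j i
                  - 2 * \sum_i \sum_j f7 i j).
  rewrite !mulr_sumr -!(sumrB, big_split) !mulr_sumr -!(sumrB, big_split) /=.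
  apply: eq_bigr => i _ /=.
  rewrite !mulr_sumr -!(sumrB, big_split) !mulr_sumr -!(sumrB, big_split) /=.
  by apply: eq_bigr => j _.
have sum2 (s t : 'I_n -> R) :
    \sum_i \sum_j s i * t j = (\sum_i s i) * (\sum_i t i).
  by rewrite mulr_suml; apply: eq_bigr => i _; rewrite mulr_sumr.
rewrite [\sum_i \sum_j f6 j i]exchange_big.
rewrite /f2 /f4 /f6 (sum2 (fun i => inner G (E i) (h (E i)))).
rewrite (sum2 (fun i => inner G (E i) (phi (h (E i))))).
rewrite (sum2 (fun i => eta (E i) ^+ 2)) /f1 /f3 /f5 /f7.
by field.
Qed.

Lemma sum_lt_frob (M : 'I_n -> 'I_n -> 'rV[R]_d) :
  (forall i j, M i j = M j i) ->
  \sum_(i < n) \sum_(j < n | (i < j)%N)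
    (inner G (M i i) (M j j) - inner G (M i j) (M i j)) =
  2^-1 * (inner G (\sum_i M i i) (\sum_i M i i) - frob G M M).
Proof.
move=> MS; rewrite sum_lt_sym; first last.
- by move=> i; rewrite subrr.
- by move=> i j; rewrite Gsym (MS i j).
congr (_ * _); rewrite inner_suml -sumrB; apply: eq_bigr => i _.
by rewrite inner_sumr -sumrB.
Qed.

End SpaceFormScalar.

(** * Gauss equation in terms of curvature, alpha' and the second fundamental form *)

Section GaussInvariant.
Variables (R : realType) (n d : nat).
Variables (O : set 'rV[R]_d) (g : 'rV[R]_d -> 'M[R]_d) (P : 'rV[R]_d -> 'rV[R]_d).
Hypotheses (oO : open O) (sg : smooth_on O g) (sP : smooth_on O P).
Hypothesis gsym : forall x, O x -> (g x)^T = g x.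
Hypothesis gpos : forall (x u : 'rV[R]_d), O x -> u != 0 -> 0 < inner (g x) u u.
Variables (a b : R) (U : set 'rV[R]_n) (f : 'rV[R]_n -> 'rV[R]_d).
Hypotheses (oU : open U) (sf : smooth_on U f) (fO : forall z, U z -> O (f z)).
Hypothesis finj : forall z, U z -> injective ('d f z).
Variable y : 'rV[R]_n.
Hypothesis Uy : U y.
Let G := inner (g (f y)).
Let pi_ V := G (P (f y)) V.

Variables (D : 'rV[R]_n -> 'rV[R]_d) (al : 'rV[R]_d -> 'rV[R]_d -> R).
Variables (Rc : 'rV[R]_d -> 'rV[R]_d -> 'rV[R]_d -> 'rV[R]_d).
Variable (II : 'rV[R]_n -> 'rV[R]_n -> 'rV[R]_d).
Hypothesis DE : forall u, 'd f y u = D u.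
Hypothesis alE : forall V W, nabla_dual g P (cst V) (cst W) (f y) = al V W.
Hypothesis RcE :
  forall V W Z, curvature_at (levi_civita g) (f y) V W Z = Rc V W Z.
Hypothesis IIE : forall u v, sff g P a b f y u v = II u v.

(** Eliminating such an existential gives the derivative an opaque name together with its defining
    equation. *)
Let DgX : exists Dg, forall x u : 'rV[R]_d, 'D_u g x = Dg x u.
Proof. by exists (fun x u => 'D_u g x). Qed.

Let DfX : exists Df : 'rV[R]_n -> 'rV[R]_n -> 'rV[R]_d,
  forall u z, 'D_u f z = Df u z.
Proof. by exists (fun u z => 'D_u f z). Qed.

Let DDfX (Df : 'rV[R]_n -> 'rV[R]_n -> 'rV[R]_d) :
  exists DDf : 'rV[R]_n -> 'rV[R]_n -> 'rV[R]_n -> 'rV[R]_d,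
  forall u v z, 'D_u (Df v) z = DDf u v z.
Proof. by exists (fun u v z => 'D_u (Df v) z). Qed.

Lemma gauss_riem u v w k :
  induced_riem g P a b f y u v w k =
  G (Rc (D u) (D v) (D w)) (D k)
  + a * (al (D u) (D v) - al (D v) (D u)) * G (D w) (D k)
  + b * (al (D u) (D w) + pi_ (II u w)) * G (D v) (D k)
  - b * (al (D v) (D w) + pi_ (II v w)) * G (D u) (D k)
  + b ^+ 2 * pi_ (D w) * (pi_ (D v) * G (D u) (D k) - pi_ (D u) * G (D v) (D k))
  + G (II v w) (II u k) - G (II u w) (II v k).
Proof.
have [Dg DgE] := DgX; have [Df DfE] := DfX; have [DDf DDfE] := DDfX Df.
have [dpi dpiE] : exists dpi : 'rV[R]_d -> 'rV[R]_d -> R,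
    forall V W, 'D_V (fun x => inner (g x) (P x) W) (f y) = dpi V W.
  by exists (fun V W => 'D_V (fun x => inner (g x) (P x) W) (f y)).
have [DC DCE] : exists DC : 'rV[R]_d -> 'rV[R]_d -> 'rV[R]_d -> 'rV[R]_d,
    forall V W Z, 'D_V (fun x => christoffel g x W Z) (f y) = DC V W Z.
  by exists (fun V W Z => 'D_V (fun x => christoffel g x W Z) (f y)).
have [D3 D3E] : exists D3 : 'rV[R]_n -> 'rV[R]_n -> 'rV[R]_n -> 'rV[R]_d,
    forall u v w, 'D_u (DDf v w) y = D3 u v w.
  by exists (fun u v w => 'D_u (DDf v w) y).
have Dy t : Df t y = D t by rewrite -DE (diff_Df sf DfE).
have := gauss_equation oO sg sP gsym gpos oU sf fO finj DgE DfE DDfE Uy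
  dpiE DCE D3E (fun _ _ _ => erefl) u v w k.
rewrite /= !Dy => ->; rewrite !IIE.
have alC V W : dpi V W - inner (g (f y)) (P (f y)) (christoffel g (f y) V W) =
    al V W.
  by rewrite -alE nabla_dual_cst dpiE.
rewrite !alC -RcE curvature_levi_civita_cst ?DCE //.
exact: (christoffel_linl oO sg DgE gsym gpos _ (fO Uy)).
Qed.

Lemma gauss_sff_sym u v : II u v = II v u.
Proof.
have [Dg DgE] := DgX; have [Df DfE] := DfX; have [DDf DDfE] := DDfX Df.
rewrite -!IIE.
exact: (sff_sym P oO sg gsym gpos a b oU sf fO finj DgE DfE DDfE u v Uy).
Qed.

Lemma gauss_sff_lin u : linear (II u).
Proof.
have [Dg DgE] := DgX; have [Df DfE] := DfX; have [DDf DDfE] := DDfX Df.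
move=> k v w; rewrite -!IIE.
exact: (sff_lin P sg gpos a b oU sf fO DgE DfE DDfE u Uy k v w).
Qed.

Lemma gauss_inner_pullback u v : inner (pullback g f y) u v = G (D u) (D v).
Proof.
have [Df DfE] := DfX; have Dy t : Df t y = D t by rewrite -DE (diff_Df sf DfE).
by rewrite (inner_pullback g sf DfE u v Uy) !Dy.
Qed.

Lemma gauss_inner_tangential W u :
  inner (pullback g f y) (tangential g f y W) u = G W (D u).
Proof.
have [Df DfE] := DfX; have Dy t : Df t y = D t by rewrite -DE (diff_Df sf DfE).
by rewrite (inner_tangential gpos sf fO finj DfE W u Uy) Dy.
Qed.

End GaussInvariant.

(** * The pointwise inequality *)

Lemma sum_I2 (V : zmodType) (F : 'I_2 -> V) : \sum_(k < 2) F k = F 0 + F 1.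
Proof.
rewrite !big_ord_recl big_ord0 addr0.
by congr (F _ + F _); apply: val_inj.
Qed.

Lemma det_on2 (R : realType) (d : nat) (G : 'M[R]_d)
    (T : 'rV[R]_d -> 'rV[R]_d) (S : 'I_2 -> 'rV[R]_d) :
  det_on G T S = inner G (T (S 0)) (S 0) * inner G (T (S 1)) (S 1)
                 - inner G (T (S 0)) (S 1) * inner G (T (S 1)) (S 0).
Proof.
rewrite /det_on (expand_det_row _ 0) sum_I2 /cofactor !det_mx11 !mxE.
have -> : lift (0 : 'I_2) 0 = 1 by apply: val_inj.
have -> : lift (1 : 'I_2) 0 = 0 by apply: val_inj.
by rewrite /= expr0 expr1; ring.
Qed.

(** The matrix [B] of the family satisfies B M B^T = 1. For square matrices a right inverse is a
    left inverse, so M B^T B = 1, which is the expansion. *)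
Lemma orthonormal_expand (R : realType) (n : nat) (M : 'M[R]_n)
    (e : 'I_n -> 'rV[R]_n) (w : 'rV[R]_n) : orthonormal_fam M e ->
  w = \sum_i inner M w (e i) *: e i.
Proof.
move=> he; pose B : 'M[R]_n := \matrix_i e i.
have BB : B *m (M *m B^T) = 1%:M.
  apply/matrixP => i k.
  have -> : (B *m (M *m B^T)) i k = (row i B *m (M *m B^T)) 0 k.
    by rewrite -row_mul [RHS]mxE.
  by rewrite inner_row !rowK he mxE.
rewrite -{1}[w]mulmx1 -(mulmx1C BB) mulmxA mulmx_sum_row.
by apply: eq_bigr => i _; rewrite inner_row rowK.
Qed.

Section Pointwise.
Variables (R : realType) (n d : nat) (G : 'M[R]_d) (M : 'M[R]_n).
Variables (D : 'rV[R]_n -> 'rV[R]_d) (tan : 'rV[R]_d -> 'rV[R]_n).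
Hypothesis Gsym : forall u v, inner G u v = inner G v u.
Hypothesis Gge0 : forall u, 0 <= inner G u u.
Hypothesis Dlin : linear D.
Hypothesis MD : forall u v, inner M u v = inner G (D u) (D v).
Hypothesis tanE : forall W u, inner M (tan W) u = inner G W (D u).
Variable e : 'I_n -> 'rV[R]_n.
Hypothesis he : orthonormal_fam M e.
Let E k := D (e k).
Let top W := D (tan W).

Lemma inner_top i W : inner G (E i) (top W) = inner G (E i) W.
Proof. by rewrite Gsym -MD tanE Gsym. Qed.

Lemma linear_expand_frame (V : lmodType R) (L : 'rV[R]_n -> V) w :
  linear L -> L w = \sum_i inner M w (e i) *: L (e i).
Proof.
move=> Ll; pose L' : {linear 'rV[R]_n -> V} :=
  HB.pack L (GRing.isLinear.Build _ _ _ _ _ Ll).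
rewrite {1}(orthonormal_expand w he) -[L]/(L' : _ -> _) linear_sum.
by apply: eq_bigr => i _; rewrite linearZ.
Qed.

Lemma top_expand W : top W = \sum_i inner G W (E i) *: E i.
Proof.
rewrite /top (linear_expand_frame _ Dlin).
by apply: eq_bigr => i _; rewrite tanE.
Qed.

Lemma tr_on_top T : tr_on G (top \o T) E = \sum_i inner G (E i) (T (E i)).
Proof. by apply: eq_bigr => i _; rewrite /= inner_top. Qed.

Lemma sqnorm_on_top T :
  sqnorm_on G (top \o T) E = \sum_i \sum_j inner G (E i) (T (E j)) ^+ 2.
Proof.
by apply: eq_bigr => i _; apply: eq_bigr => j _; rewrite /= inner_top.
Qed.

Lemma inner_top_top W : inner G (top W) (top W) = \sum_i inner G W (E i) ^+ 2.
Proof.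
rewrite {1}top_expand inner_suml; apply: eq_bigr => i _.
by rewrite innerZl inner_top [inner G (E i) W]Gsym.
Qed.

Lemma inner_top_lin W (T : 'rV[R]_d -> 'rV[R]_d) : linear T ->
  inner G (top W) (T (top W)) =
  \sum_i \sum_j inner G W (E i) * inner G W (E j) * inner G (E i) (T (E j)).
Proof.
move=> Tl; pose T' : {linear 'rV[R]_d -> 'rV[R]_d} :=
  HB.pack T (GRing.isLinear.Build _ _ _ _ _ Tl).
rewrite top_expand inner_suml; apply: eq_bigr => i _.
rewrite innerZl -[T]/(T' : _ -> _) linear_sum inner_sumr mulr_sumr.
by apply: eq_bigr => j _; rewrite linearZ innerZr mulrA.
Qed.

Variable II : 'rV[R]_n -> 'rV[R]_n -> 'rV[R]_d.
Hypothesis IIsym : forall u v, II u v = II v u.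
Hypothesis IIlin : forall u, linear (II u).

(** Translates the coordinate expressions of [chen_inequality] back into values of the second
    fundamental form on arbitrary tangent vectors, in particular on the basis of the plane. *)
Lemma quad_sff u v :
  quad (fun i j => II (e i) (e j)) (fun i => inner M u (e i))
       (fun i => inner M v (e i)) = II u v.
Proof.
rewrite (linear_expand_frame v (IIlin u)) /quad exchange_big; apply: eq_bigr => j _.
rewrite IIsym (linear_expand_frame u (IIlin (e j))) scaler_sumr.
by apply: eq_bigr => i _; rewrite scalerA mulrC IIsym.
Qed.

(** Makes the coordinate vectors of the plane's basis orthonormal, as [chen_inequality] requires. *)
Lemma parseval u v :
  \sum_i inner M u (e i) * inner M v (e i) = inner M u v.
Proof.
rewrite [in RHS](orthonormal_expand u he) inner_suml; apply: eq_bigr => i _.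
by rewrite innerZl [inner M (e i) v]MD Gsym -MD.
Qed.

Variables (kappa mu c a b : R) (Ph h : 'rV[R]_d -> 'rV[R]_d).
Variables (xi Pp : 'rV[R]_d) (et : 'rV[R]_d -> R).
Variable al : 'rV[R]_d -> 'rV[R]_d -> R.
Let ph v := Ph (h v).
Let pi_ v := inner G Pp v.
Hypothesis skew : forall u v, inner G u (Ph v) = - inner G (Ph u) v.
Hypothesis dual : forall u, inner G u xi = et u.
Hypothesis hsym : forall u v, inner G u (h v) = inner G (h u) v.
Hypothesis phsym : forall u v, inner G u (ph v) = inner G (ph u) v.
Hypothesis hlin : linear h.

Variable riem : 'rV[R]_n -> 'rV[R]_n -> 'rV[R]_n -> 'rV[R]_n -> R.
Hypothesis riemE : forall u v w k, riem u v w k =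
  inner G (space_form_curvature kappa mu c G Ph h xi et (D u) (D v) (D w)) (D k)
  + a * (al (D u) (D v) - al (D v) (D u)) * inner G (D w) (D k)
  + b * (al (D u) (D w) + pi_ (II u w)) * inner G (D v) (D k)
  - b * (al (D v) (D w) + pi_ (II v w)) * inner G (D u) (D k)
  + b ^+ 2 * pi_ (D w)
    * (pi_ (D v) * inner G (D u) (D k) - pi_ (D u) * inner G (D v) (D k))
  + inner G (II v w) (II u k) - inner G (II u w) (II v k).

Let sect u v := 2^-1 * (riem u v v u - riem u v u v).
Let x u := b ^+ 2 / 2 * pi_ (D u) ^+ 2 - b / 2 * (al (D u) (D u) + pi_ (II u u)).

(** Each a-term carries the product of [D u] and [D v], which is zero. Of the b-terms, R(u,v,v,u)
    keeps those in [v] and R(u,v,u,v) those in [u]; [x] is the share of one direction. *)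
Lemma symmetrized_sectionalE u v :
  inner M u u = 1 -> inner M v v = 1 -> inner M u v = 0 ->
  sect u v = space_form_sectional G kappa mu c Ph h et (D u) (D v)
    + (x u + x v)
    + (inner G (II u u) (II v v) - inner G (II u v) (II u v)).
Proof.
rewrite !MD => uu vv uv.
have [E1 E2] := space_form_sectionalE kappa mu c Gsym skew dual hsym phsym
  uu vv uv.
have vu : inner G (D v) (D u) = 0 by rewrite Gsym.
rewrite /sect !riemE E1 E2 uu vv uv vu (IIsym v u) (Gsym (II v v)) /x.
by field.
Qed.

Hypothesis hn : (3 <= n)%N.
Variable s : 'I_2 -> 'rV[R]_n.
Hypothesis hs : orthonormal_fam M s.
Let S k := D (s k).

Let e1 := S 0.
Let e2 := S 1.
Let H := n%:R^-1 *: \sum_(i < n) II (e i) (e i).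
Let lambda' := \sum_(k < n) al (E k) (E k).
Let P_Pi := \sum_(k < 2) inner G Pp (S k) *: S k.
Let nR : R := n%:R.

(** The trace of the second fundamental form is nH, which turns Chen's constant into
    n^2(n-2)/(2(n-1)). Each frame vector contributes its b-terms n-1 times, and those of the plane
    are subtracted once. *)
Lemma pointwise_inequality :
  (\sum_(i < n) \sum_(j < n | (i < j)%N) sect (e i) (e j)) - sect (s 0) (s 1)
  <= (nR + 1) * (nR - 2) / 2 * ((c + 3) / 4)
     + (c + 3 - 4 * kappa) / 4 *
       (- (nR - 1) * inner G (top xi) (top xi) + (et e1 ^+ 2 + et e2 ^+ 2))
     + (c - 1) / 8 * (3 * sqnorm_on G (top \o Ph) E
                      - 6 * inner G (Ph e1) e2 ^+ 2)
     + 4^-1 * (sqnorm_on G (top \o ph) E - sqnorm_on G (top \o h) E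
               + `|tr_on G (top \o h) E| ^+ 2
               - `|tr_on G (top \o ph) E| ^+ 2)
     - 2^-1 * (det_on G h S - det_on G ph S)
     + (nR - 1) * tr_on G (top \o h) E - tr_on G h S
     + (1 - mu) * (inner G (top xi) (h (top xi))
                   - tr_on G (top \o h) E * inner G (top xi) (top xi)
                   + (et e1 ^+ 2 * inner G (h e2) e2
                      + et e2 ^+ 2 * inner G (h e1) e1
                      - 2 * et e1 * et e2 * inner G (h e1) e2))
     - (nR - 1) / 2 * b * lambda'
     + (nR - 1) / 2 * b ^+ 2 * inner G (top Pp) (top Pp)
     - b / 2 * (nR - 1) * nR * pi_ H
     + b / 2 * (\sum_(k < 2) al (S k) (S k))
     - b ^+ 2 / 2 * inner G P_Pi P_Pi
     + b / 2 * pi_ (\sum_(k < 2) II (s k) (s k))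
     + nR ^+ 2 * (nR - 2) / (2 * (nR - 1)) * inner G H H.
Proof.
pose N i j := II (e i) (e j).
have nR0 : nR != 0 by rewrite pnatr_eq0 -lt0n (leq_trans _ hn).
have nR1 : 2 * (nR - 1) != 0.
  apply: lt0r_neq0; rewrite mulr_gt0 // subr_gt0 ltr1n.
  exact: leq_trans hn.
have s00 : inner M (s 0) (s 0) = 1 by rewrite hs eqxx.
have s11 : inner M (s 1) (s 1) = 1 by rewrite hs eqxx.
have s01 : inner M (s 0) (s 1) = 0 by rewrite hs.
have HE : nR *: H = \sum_i N i i by rewrite /H scalerA mulfV // scale1r.
have chen := chen_inequality Gsym Gge0 hn (fun i j => IIsym (e i) (e j))
  (etrans (parseval (s 0) (s 0)) s00) (etrans (parseval (s 1) (s 1)) s11)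
  (etrans (parseval (s 0) (s 1)) s01) HE.
rewrite !quad_sff in chen.
have -> : \sum_(i < n) \sum_(j < n | (i < j)%N) sect (e i) (e j) =
    \sum_(i < n) \sum_(j < n | (i < j)%N)
      space_form_sectional G kappa mu c Ph h et (E i) (E j)
    + \sum_(i < n) \sum_(j < n | (i < j)%N) (x (e i) + x (e j))
    + \sum_(i < n) \sum_(j < n | (i < j)%N)
      (inner G (N i i) (N j j) - inner G (N i j) (N i j)).
  rewrite -!big_split; apply: eq_bigr => i _; rewrite -!big_split.
  apply: eq_bigr => j ij; rewrite symmetrized_sectionalE ?he ?eqxx //.
  by rewrite -val_eqE (ltn_eqF ij).
rewrite (sum_space_form_sectional kappa mu c et E Gsym skew hsym phsym).
rewrite sum_lt_add (sum_lt_frob Gsym (fun i j => IIsym (e i) (e j))).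
rewrite -HE (symmetrized_sectionalE s00 s11 s01) /space_form_sectional.
rewrite -/(S 0) -/(S 1) -/e1 -/e2.
rewrite !sqnorm_on_top !tr_on_top !real_normK ?num_real // !det_on2.
rewrite !inner_top_top (inner_top_lin xi hlin) {1}/tr_on !sum_I2.
rewrite -/e1 -/e2.
have xiE u : inner G xi u = et u by rewrite Gsym dual.
have -> : \sum_i inner G xi (E i) ^+ 2 = \sum_i et (E i) ^+ 2.
  by apply: eq_bigr => i _; rewrite xiE.
have -> : \sum_i \sum_j inner G xi (E i) * inner G xi (E j)
      * inner G (E i) (h (E j)) =
    \sum_i \sum_j et (E i) * et (E j) * inner G (E i) (h (E j)).
  by apply: eq_bigr => i _; apply: eq_bigr => j _; rewrite !xiE.
have -> : \sum_i x (e i) = b ^+ 2 / 2 * \sum_i inner G Pp (E i) ^+ 2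
    - b / 2 * (lambda' + nR * pi_ H).
  have -> : nR * pi_ H = \sum_i pi_ (N i i) by rewrite /pi_ -innerZr HE inner_sumr.
  by rewrite -big_split !mulr_sumr -sumrB.
have -> : inner G P_Pi P_Pi = pi_ e1 ^+ 2 + pi_ e2 ^+ 2.
  have := hs 0 0; have := hs 1 1; have := hs 0 1; have := hs 1 0.
  rewrite !MD -!/(S _) -/e1 -/e2 !eqxx /= => o10 o01 o11 o00.
  by rewrite /P_Pi sum_I2 -/e1 -/e2 -!/(pi_ _) !innerE o10 o01 o11 o00; ring.
(* Products with h' and phi h' are brought to one orientation, so that equal quantities become the
   same atom. *)
rewrite -!hsym -!phsym [inner G e2 (h e1)]hsym [inner G (h e2) e1]Gsym.
rewrite [inner G e2 (ph e1)]phsym [inner G (ph e2) e1]Gsym.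
rewrite /x -/(S 0) -/(S 1) -/e1 -/e2 [pi_ (_ + _)]innerDr -!/(pi_ _) -/nR -!/(ph _).
have HH : inner G (nR *: H) (nR *: H) = nR ^+ 2 * inner G H H.
  by move: H => H'; rewrite innerZl innerZr mulrA.
rewrite HH -!/nR in chen *.
(* The slack in Chen's inequality and the slack in the goal are the same number, which leaves an
   identity. *)
rewrite -subr_ge0 in chen; rewrite -subr_ge0; apply: le_trans chen _.
rewrite le_eqVlt; apply/orP; left; apply/eqP.
move: (\sum_i \sum_j inner G (E i) (Ph (E j)) ^+ 2)
  (\sum_i \sum_j inner G (E i) (h (E j)) ^+ 2)
  (\sum_i \sum_j inner G (E i) (ph (E j)) ^+ 2)
  (\sum_i \sum_j et (E i) * et (E j) * inner G (E i) (h (E j)))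
  (\sum_i inner G (E i) (h (E i))) (\sum_i inner G (E i) (ph (E i)))
  (\sum_i et (E i) ^+ 2) (\sum_i inner G Pp (E i) ^+ 2) (frob _ _ _)
  (inner G H H) => S1 S2 S3 S4 S5 S6 S7 S8 S9 S10.
have n1 : nR - 1 != 0 by move: nR1; rewrite mulf_eq0 negb_or => /andP[].
by field.
Qed.

End Pointwise.

(** * From chart data to the theorem on manifolds *)

Section ImmersionDomain.
Variables (R : realType) (n d : nat) (M : manifold R n) (N : manifold R d).
Variables (F : M -> N) (i : mindex M) (j : mindex N).

(** On an open set, continuity within the set is continuity at each of its points, so [F \o param i]
    pulls the open chart domain back to a neighbourhood of each point. *)
Lemma open_immersion_domain : continuous F ->
  open [set y | mcoord i y /\ mdom j (F (param i y))].
Proof.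
move=> cF; have oi : open (mcoord i) by exact: mcoord_open.
rewrite openE => y [yi Fy]; apply: filterI; first exact: open_near.
have := @param_continuous _ _ M i; rewrite continuous_open_subspace // => cp.
have cy : {for y, continuous (F \o param i)}.
  by apply: continuous_comp; [apply: cp; rewrite inE | exact: cF].
exact: (cy _ (open_nbhs_nbhs (conj (mdom_open j) Fy))).
Qed.

End ImmersionDomain.

Theorem theorem4p1 (R : realType) (m n : nat) (kappa mu c a b : R)
    (N : manifold R (2 * m).+1)
    (g : metric N) (phi : endo_field N) (xi : vector_field N)
    (eta : one_form N) (P : vector_field N)
    (M : manifold R n) (F : M -> N)
    (hn : (3 <= n)%N)
    (hN : contact_space_form g phi xi eta kappa mu c)
    (hF : immersion F)
    (x : M) (i : mindex M) (j : mindex N)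
    (hi : mdom i x) (hj : mdom j (F x)) :
  let f := local_rep F i j in
  let y := chart i x in
  let p := chart j (F x) in
  let G := inner (g j p) in
  let gM := pullback (g j) f y in
  let df := fun u : 'rV[R]_n => 'd f y u in
  let top := fun W : 'rV[R]_(2 * m).+1 => df (tangential (g j) f y W) in
  let Ph := fun v : 'rV[R]_(2 * m).+1 => v *m phi j p in
  let h := hprime (phi j) (xi j) p in
  let ph := fun v : 'rV[R]_(2 * m).+1 => Ph (h v) in
  let et := ev1 (eta j p) in
  let pi_ := fun v : 'rV[R]_(2 * m).+1 => G (P j p) v in
  let alpha' := fun u v : 'rV[R]_(2 * m).+1 =>
    nabla_dual (g j) (P j) (cst u) (cst v) p in
  let sff_ := sff (g j) (P j) a b f y in
  let hT := top \o h in
  let phT := top \o ph in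
  let PhT := top \o Ph in
  let xiT := top (xi j p) in
  let PT := top (P j p) in
  forall (e : 'I_n -> 'rV[R]_n), orthonormal_fam gM e ->
  forall (Pi : {vspace 'rV[R]_n}), \dim Pi = 2%N ->
  forall (s : 'I_2 -> 'rV[R]_n), (forall k, s k \in Pi) ->
    orthonormal_fam gM s ->
  let E := fun k => df (e k) in
  let S := fun k => df (s k) in
  let e1 := S 0 in
  let e2 := S 1 in
  let H := mean_curvature (g j) (P j) a b f y e in
  let lambda' := \sum_(k < n) alpha' (E k) (E k) in
  let P_Pi := \sum_(k < 2) G (P j p) (S k) *: S k in
  let beta := G (Ph e1) e2 ^+ 2 in
  let gamma := et e1 ^+ 2 + et e2 ^+ 2 in
  let theta := et e1 ^+ 2 * G (h e2) e2 + et e2 ^+ 2 * G (h e1) e1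
               - 2 * et e1 * et e2 * G (h e1) e2 in
  let tr_alpha'_Pi := \sum_(k < 2) alpha' (S k) (S k) in
  let tr_sff_Pi := \sum_(k < 2) sff_ (s k) (s k) in
  let nR := n%:R : R in
  induced_scalar (g j) (P j) a b f y e
  - induced_sectional (g j) (P j) a b f y (s 0) (s 1)
  <= (nR + 1) * (nR - 2) / 2 * ((c + 3) / 4)
     + (c + 3 - 4 * kappa) / 4 * (- (nR - 1) * G xiT xiT + gamma)
     + (c - 1) / 8 * (3 * sqnorm_on (g j p) PhT E - 6 * beta)
     + 4^-1 * (sqnorm_on (g j p) phT E - sqnorm_on (g j p) hT E
               + `|tr_on (g j p) hT E| ^+ 2 - `|tr_on (g j p) phT E| ^+ 2)
     - 2^-1 * (det_on (g j p) h S - det_on (g j p) ph S)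
     + (nR - 1) * tr_on (g j p) hT E - tr_on (g j p) h S
     + (1 - mu) * (G xiT (h xiT) - tr_on (g j p) hT E * G xiT xiT + theta)
     - (nR - 1) / 2 * b * lambda'
     + (nR - 1) / 2 * b ^+ 2 * G PT PT
     - b / 2 * (nR - 1) * nR * pi_ H
     + b / 2 * tr_alpha'_Pi
     - b ^+ 2 / 2 * G P_Pi P_Pi
     + b / 2 * pi_ tr_sff_Pi
     + nR ^+ 2 * (nR - 2) / (2 * (nR - 1)) * G H H.
Proof.
move=> f y p G gM df top Ph h ph et pi_ alpha' sff_ hT phT PhT xiT PT e he Pi _
  s _ hs.
(* Ambient tensors are taken at [p] and the immersion at [y]; identifying [p] with [f y] lets the
   local lemmas apply. *)
have pE : p = f y by rewrite /f /local_rep /= chartK.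
clearbody p; subst p.
case: hN => [[[acm hctc] _] _ hcurv]; case: hF => cF /(_ i j)[sf finj].
set U := [set z | _] in sf finj.
have yi : mcoord i y by exists x.
have Uy : U y by split=> //; rewrite /y chartK.
have oU : open U by exact: open_immersion_domain.
have oO : open (mcoord j : set 'rV[R]_(2 * m).+1) by exact: mcoord_open.
have fO z : U z -> mcoord j (f z) by move=> [_ Fz]; exists (F (param i z)).
have Oy := fO _ Uy.
have sg := @mt_smooth _ _ _ g j; have sP := @vf_smooth _ _ _ P j.
have sphi := @ef_smooth _ _ _ phi j; have sxi := @vf_smooth _ _ _ xi j.
have seta := @of_smooth _ _ _ eta j.
have gsym z : mcoord j z -> (g j z)^T = g j z by exact: mt_sym.
have gpos (z u : 'rV[R]_(2 * m).+1) :
  mcoord j z -> u != 0 -> 0 < inner (g j z) u u by exact: mt_pos.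
have eta_xi z : mcoord j z -> ev1 (eta j z) (xi j z) = 1 by exact: (acm_eta_xi acm).
have phi_xi z : mcoord j z -> xi j z *m phi j z = 0 by exact: (acm_phi_xi acm).
have phi2 (z u : 'rV[R]_(2 * m).+1) : mcoord j z ->
  u *m phi j z *m phi j z = - u + ev1 (eta j z) u *: xi j z by exact: (acm_phi2 acm).
have skew (z u v : 'rV[R]_(2 * m).+1) : mcoord j z ->
  inner (g j z) u (v *m phi j z) = - inner (g j z) (u *m phi j z) v.
  exact: (acm_skew acm).
have dual (z u : 'rV[R]_(2 * m).+1) : mcoord j z ->
  inner (g j z) u (xi j z) = ev1 (eta j z) u by exact: (acm_dual acm).
have Gsym u v : G u v = G v u by apply: inner_sym; exact: gsym.
have Gge0 u : 0 <= G u u.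
  have [->|u0] := eqVneq u 0; first by rewrite /G inner0l.
  exact: ltW (gpos _ _ Oy u0).
(* The contact condition [hctc] is what makes h' symmetric. The derivatives are named by themselves,
   hence the reflexivity proofs. *)
have hsym u v : G u (h v) = G (h u) v.
  exact: (hprime_sym oO sg sphi sxi seta gsym phi2 eta_xi phi_xi skew dual
    (hctc j) Oy (fun _ _ => erefl) (fun _ _ => erefl) (fun _ _ => erefl)
    (fun _ _ => erefl) erefl erefl u v).
have phsym u v : G u (ph v) = G (ph u) v.
  exact: (hprime_phi_sym oO sg sphi sxi seta gsym eta_xi phi_xi skew
    (hctc j) Oy (fun _ _ => erefl) (fun _ _ => erefl) (fun _ _ => erefl)
    (fun _ _ => erefl) erefl erefl u v).
have hlin : linear h.
  exact: (hprime_lin sphi sxi Oy (fun _ _ => erefl) erefl).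
have dflin : linear df by move=> k u v; exact: linearP.
have MD := gauss_inner_pullback (g j) sf Uy (fun u => erefl (df u)).
have tanE := gauss_inner_tangential gpos sf fO finj Uy (fun u => erefl (df u)).
have IIsym := gauss_sff_sym oO sg gsym gpos oU sf fO finj Uy
  (fun u v => erefl (sff_ u v)).
have IIlin := gauss_sff_lin sg gpos oU sf fO Uy (fun u v => erefl (sff_ u v)).
(* [hcurv] puts the space form expression in place of the ambient curvature. *)
have riemE := gauss_riem oO sg sP gsym gpos oU sf fO finj Uy
  (fun u => erefl (df u)) (fun V W => erefl (alpha' V W))
  (fun V W Z => hcurv j (f y) V W Z Oy) (fun u v => erefl (sff_ u v)).
exact: (pointwise_inequality Gsym Gge0 dflin MD tanE he IIsym IIlin
  (fun u v => skew _ u v Oy) (fun u => dual _ u Oy) hsym phsym hlin riemE hn hs).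
Qed.
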